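(* Let $\mathcal{H}=\mathbb{R}^d$ with Lebesgue measure $\pi$, where each $h\in\mathbb{R}^d$ is also regarded as a measurable function $h:\mathcal{X}\to[0,1]$ (jointly measurable in $(h,x)$). Let $A:\mathcal{X}^n\to\mathbb{R}^d$ be measurable with hypothesis sensitivity coefficient $c_A$, and let $Q$ have Hamiltonian $H(h,\mathbf{x})=-\|h-A(\mathbf{x})\|^2/(2\sigma^2)$, i.e. $Q_{\mathbf{x}}=\mathcal{N}(A(\mathbf{x}),\sigma^2 I)$, where $\sigma>0$ satisfies $12nc_A^2\le\sigma^2$. Let $\mathcal{V}(A)=\mathbb{E}\left[\|A(\mathbf{X})-\mathbb{E}[A(\mathbf{X}')]\|^2\right]$ and $\delta>0$. Then: (i) If $n>8$, $\ln\mathbb{E}_{\mathbf{X}}\left[\mathbb{E}_{h\sim Q_{\mathbf{X}}}\left[e^{(n/2)\,kl(\hat L(h,\mathbf{X}),L(h))}\right]\right]\le \frac{3}{\sigma^2}\mathcal{V}(A)+\frac12\ln(2\sqrt n)$. (ii) If $n>8$, with probability at least $1-\delta$ as $\mathbf{X}\sim\mu^n$, $$\mathbb{E}_{h\sim Q_{\mathbf{X}}}\left[kl(\hat L(h,\mathbf{X}),L(h))\right]\le\frac{\frac{6}{\sigma^2}\mathcal{V}(A)+\ln(2\sqrt n)+2\ln(1/\delta)}{n}.$$ (iii) With probability at least $1-\delta$ as $\mathbf{X}\sim\mu^n$ and $h\sim Q_{\mathbf{X}}$, $\Delta(h,\mathbf{X})\le\sqrt{\frac{(3/\sigma^2)\mathcal{V}(A)+\ln(1/\delta)}{n}}$.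 (iv) With $v(h)=\mathbb{E}[(h(X)-\mathbb{E}[h(X')])^2]$, with probability at least $1-\delta$ as $\mathbf{X}\sim\mu^n$ and $h\sim Q_{\mathbf{X}}$, $$\Delta(h,\mathbf{X})\le 2\sqrt{v(h)\frac{(3/\sigma^2)\mathcal{V}(A)+\ln(1/\delta)}{n}}+\frac{(3/\sigma^2)\mathcal{V}(A)+\ln(1/\delta)}{n}.$$
   Context: $\mathcal{X}$ is a measurable space with probability measure $\mu$, $\mathbf{X}=(X_1,\dots,X_n)\sim\mu^n$, $\mathbf{X}'$ an independent copy, $X,X'\sim\mu$ independent. $\|\cdot\|$ is the Euclidean norm. The hypothesis sensitivity coefficient of $A$ is $c_A=\max_{k\in[n]}\sup_{\mathbf{x}\in\mathcal{X}^n,\,y,y'\in\mathcal{X}}\|A(S^k_y\mathbf{x})-A(S^k_{y'}\mathbf{x})\|$, where $S^k_y\mathbf{x}$ replaces the $k$-th coordinate of $\mathbf{x}$ by $y$. Expected loss $L(h)=\mathbb{E}[h(X)]$, empirical loss $\hat L(h,\mathbf{x})=\frac1n\sum_{i=1}^n h(x_i)$, generalization gap $\Delta(h,\mathbf{x})=L(h)-\hat L(h,\mathbf{x})$. For $s,t\in[0,1]$, $kl(s,t)=s\ln\frac{s}{t}+(1-s)\ln\frac{1-s}{1-t}$ (relative entropy of Bernoulli laws). Probability ''as $\mathbf{X}\sim\mu^n$ and $h\sim Q_{\mathbf{X}}$'' is w.r.t. the joint law. *)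

(* Defs.v *)
From HB Require Import structures.
From mathcomp Require Import all_boot all_order all_algebra.
From mathcomp Require Import all_classical all_reals all_analysis.

Set Implicit Arguments.
Unset Strict Implicit.
Unset Printing Implicit Defensive.

Import Order.TTheory GRing.Theory Num.Theory.
Local Open Scope classical_set_scope.
Local Open Scope ring_scope.

Section defs.
Context {R : realType}.

(* Iterated integral over n.-tuples w.r.t. the product of the measures
   P 0, P 1, ..., P (n-1): integral w.r.t. the product measure
   (Tonelli/Fubini) for nonnegative measurable integrands. *)
Fixpoint iter_int {dT} {T : measurableType dT} (n : nat) :
  (nat -> {measure set T -> \bar R}) -> (n.-tuple T -> \bar R) -> \bar R :=
  match n return (nat -> {measure set T -> \bar R}) -> (n.-tuple T -> \bar R) -> \bar R with
  | 0%N => fun _ g => g [tuple]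
  | m.+1 => fun P g =>
      (\int[P 0%N]_x iter_int (fun i => P i.+1) (fun t => g (cons_tuple x t)))%E
  end.

Context {dX : measure_display} {X : measurableType dX}.

Definition EXn (mu : probability X R) (n : nat) (g : n.-tuple X -> \bar R) : \bar R :=
  @iter_int _ _ n (fun _ => mu) g.

Definition dist2 (d : nat) (a b : d.-tuple R) : R :=
  \sum_(i < d) (tnth a i - tnth b i) ^+ 2.

Definition replace_at (n : nat) (x : n.-tuple X) (k : 'I_n) (y : X) : n.-tuple X :=
  [tuple if i == k then y else tnth x i | i < n].

Definition hyp_sens (n d : nat) (A : n.-tuple X -> d.-tuple R) : \bar R :=
  ereal_sup [set z | exists k x y y',
    z = (Num.sqrt (dist2 (A (replace_at x k y)) (A (replace_at x k y'))))%:E].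

(* Q_x = N(A(x), sigma^2 I) : E_{h ~ Q_x}[g], product of 1-d normals *)
Definition EQ (n d : nat) (A : n.-tuple X -> d.-tuple R) (sigma : R)
  (x : n.-tuple X) (g : d.-tuple R -> \bar R) : \bar R :=
  @iter_int _ _ d (fun i => normal_prob (nth 0 (A x) i) sigma) g.

(* expected loss, empirical loss, generalization gap; f h is the function X -> [0,1] *)
Definition Lexp (mu : probability X R) (d : nat) (f : d.-tuple R -> X -> R)
  (h : d.-tuple R) : R := Rintegral mu setT (f h).

Definition Lemp (n d : nat) (f : d.-tuple R -> X -> R) (h : d.-tuple R)
  (x : n.-tuple X) : R := n%:R^-1 * \sum_(i < n) f h (tnth x i).

Definition gap (mu : probability X R) (n d : nat) (f : d.-tuple R -> X -> R)
  (h : d.-tuple R) (x : n.-tuple X) : R := Lexp mu f h - Lemp f h x.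

Definition vh (mu : probability X R) (d : nat) (f : d.-tuple R -> X -> R)
  (h : d.-tuple R) : R :=
  Rintegral mu setT (fun z => (f h z - Lexp mu f h) ^+ 2).

Definition meanA (mu : probability X R) (n d : nat) (A : n.-tuple X -> d.-tuple R)
  (i : 'I_d) : R := fine (EXn mu (fun x => (tnth (A x) i)%:E)).

Definition VA (mu : probability X R) (n d : nat) (A : n.-tuple X -> d.-tuple R) : \bar R :=
  EXn mu (fun x => (\sum_(i < d) (tnth (A x) i - meanA mu A i) ^+ 2)%:E).

Definition ProbX (mu : probability X R) (n : nat) (E : n.-tuple X -> Prop) : \bar R :=
  EXn mu (fun x => (\1_[set x | E x] x)%:E).

Definition ProbXQ (mu : probability X R) (n d : nat) (A : n.-tuple X -> d.-tuple R)
  (sigma : R) (E : n.-tuple X -> d.-tuple R -> Prop) : \bar R :=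
  EXn mu (fun x => EQ A sigma x (fun h => (\1_[set h | E x h] h)%:E)).

End defs.

(* Bernoulli relative entropy, conventions 0 ln(0/t) = 0, a ln(a/0) = +oo (a > 0) *)
Definition xlr {R : realType} (a b : R) : \bar R :=
  if a == 0 then 0%E else if b == 0 then +oo%E else (a * ln (a / b))%:E.

Definition kl {R : realType} (s t : R) : \bar R :=
  (xlr s t + xlr (1 - s) (1 - t))%E.

(* Main.v *)
Require Import Defs.
From HB Require Import structures.
From mathcomp Require Import all_boot all_order all_algebra.
From mathcomp Require Import all_classical all_reals all_analysis.
From mathcomp Require Import measurable_realfun ring lra.
Import Order.TTheory GRing.Theory Num.Theory.
Import numFieldNormedType.Exports.
Local Open Scope classical_set_scope.
Local Open Scope ring_scope.

Set Implicit Arguments.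
Unset Strict Implicit.
Unset Printing Implicit Defensive.

(** Fix any point [a] of R^d and let [lr x h] be the density of
    N(A(x), sigma^2 I) with respect to N(a, sigma^2 I).  For [G >= 0] the
    inequality [lr * G <= t/2 lr^2 + 1/(2t) G^2] reduces
    E_X E_(h ~ Q_X) G to two quantities: the moments E_X G(X, h)^2 at a fixed
    hypothesis [h], and E_X E_a lr^2 = E_X exp (|A(X) - a|^2 / sigma^2).

    The latter is at most exp (6 V / sigma^2).  Indeed Z = |A(X) - a| changes by
    at most c = sigma / sqrt (12 n) with each coordinate of X, and conditioning
    on one coordinate replaces Z by its conditional L^2 norm, which again has
    bounded differences c; so the coordinates can be integrated out one by one,
    each step costing a factor 1 + O(1 / n) in front of E Z^2.

    The moments at fixed [h] are those of an i.i.d. sum: Hoeffding's inequality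
    for (iii), a Bernstein inequality with an [h]-dependent exponent for (iv),
    and Maurer's bound E exp (n kl) <= 2 sqrt n for (i) and (ii).  The last one
    reduces by convexity to Bernoulli variables, where it is a statement about
    sum_k C(n,k) (k/n)^k (1 - k/n)^(n-k), evaluated by Abel's identity. *)

(** * Iterated integrals over product probabilities *)

(** The obstacle is that the posterior moves with the sample, so independence of the coordinates
    cannot be used under [Q_X] directly. Over a Gaussian with a fixed centre, Tonelli exchanges the
    two integrals and only moments at a frozen [h] remain. Optimizing t turns the split into a
    Cauchy-Schwarz inequality, and its square root explains the constants: exp (6 V / sigma^2)
    contributes exp (3 V / sigma^2), and (n/2) kl is the exponent whose exponential, once squared,
    is the one in Maurer's bound. Done pointwise, the split also covers [G] = +oo, which occurs
    because kl can be infinite. The 12 comes from the induction on coordinates. With the exponent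
    written Z^2 / (c^2 D), one coordinate lowers D by 4 as long as D >= 12, so losses add up instead
    of compounding; starting from D = 12 n, all n coordinates leave 8 n. The centre a stays
    arbitrary until the end, where a = E A(X) makes E Z^2 equal to V(A). *)

Section iterated_integral.
Context {R : realType}.
Local Open Scope ereal_scope.

(** [iter_int] accepts arbitrary measures; probabilities provide the total mass one and the
    sigma-finiteness used by Tonelli. The two are convertible. *)
Definition tint {d} {T : measurableType d} (P : nat -> probability T R) (n : nat)
  (g : n.-tuple T -> \bar R) : \bar R := iter_int (fun i => P i) g.

Lemma measurable_uncurry {dV dY dZ dW} {V : measurableType dV}
    {Y : measurableType dY} {Z : measurableType dZ} {W : measurableType dW}
    (u : V -> Y) (v : V -> Z) (g : Y -> Z -> W) :
  measurable_fun setT (fun p : Y * Z => g p.1 p.2) ->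
  measurable_fun setT u -> measurable_fun setT v ->
  measurable_fun setT (fun x => g (u x) (v x)).
Proof.
move=> mg mu mv.
exact: (measurableT_comp mg (measurable_fun_pair mu mv)).
Qed.

Section basic.
Context {d} {T : measurableType d}.
Implicit Types (P : nat -> probability T R) (n : nat).

Lemma tintS P n (g : n.+1.-tuple T -> \bar R) :
  tint P g = \int[P 0%N]_x tint (fun i => P i.+1) (fun t => g (cons_tuple x t)).
Proof. by []. Qed.

Lemma eq_tint P n (g1 g2 : n.-tuple T -> \bar R) :
  g1 =1 g2 -> tint P g1 = tint P g2.
Proof. by move=> /funext ->. Qed.

Lemma tint_ge0 P n (g : n.-tuple T -> \bar R) :
  (forall t, 0 <= g t) -> 0 <= tint P g.
Proof.
elim: n P g => [|n IH] P g g0; first exact: g0.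
by rewrite tintS; apply: integral_ge0 => x _; apply: IH.
Qed.

Lemma measurable_cons_tuple n :
  measurable_fun setT (fun p : T * n.-tuple T => cons_tuple p.1 p.2).
Proof. exact: measurable_cons. Qed.

(** The parameter space is arbitrary because the induction enlarges it: the next parameter is the
    pair of [y] and the first coordinate. *)
Lemma measurable_tint {d'} {Y : measurableType d'} P n
    (g : Y -> n.-tuple T -> \bar R) :
  (forall y t, 0 <= g y t) ->
  measurable_fun setT (fun p : Y * n.-tuple T => g p.1 p.2) ->
  measurable_fun [set: Y] (fun y => tint P (g y)).
Proof.
elim: n P d' Y g => [|n IH] P d' Y g g0 mg.
  exact: (measurable_uncurry (u := id) (v := fun=> [tuple]) mg).
apply: (@measurable_fun_fubini_tonelli_F _ _ _ _ _ (P 0%N)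
  (fun p => tint (fun i => P i.+1) (fun t => g p.1 (cons_tuple p.2 t)))).
  apply: (IH _ _ _ (fun p t => g p.1 (cons_tuple p.2 t))) => //.
  apply: (measurable_uncurry (u := fun p : Y * T * n.-tuple T => p.1.1)
    (v := fun p => cons_tuple p.1.2 p.2) mg); first exact: measurableT_comp.
  by apply: measurable_cons => //; exact: measurableT_comp.
by move=> p; apply: tint_ge0.
Qed.

Lemma measurable_tint_cons P n (g : n.+1.-tuple T -> \bar R) :
  (forall t, 0 <= g t) -> measurable_fun setT g ->
  measurable_fun [set: T] (fun x => tint P (fun t => g (cons_tuple x t))).
Proof.
move=> g0 mg; apply: (measurable_tint _ (fun x t => g0 (cons_tuple x t))).
exact: (measurableT_comp mg (@measurable_cons_tuple n)).
Qed.

Lemma measurable_cons_r n (g : n.+1.-tuple T -> \bar R) (x : T) :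
  measurable_fun setT g -> measurable_fun setT (fun t : n.-tuple T => g (cons_tuple x t)).
Proof. by move=> mg; apply: (measurableT_comp mg); exact: measurable_cons. Qed.

Lemma le_tint P n (g1 g2 : n.-tuple T -> \bar R) :
  (forall t, 0 <= g1 t) -> measurable_fun setT g1 -> measurable_fun setT g2 ->
  (forall t, g1 t <= g2 t) -> tint P g1 <= tint P g2.
Proof.
elim: n P g1 g2 => [|n IH] P g1 g2 g10 mg1 mg2 g12; first exact: g12.
have g20 t : 0 <= g2 t by exact: le_trans (g12 t).
rewrite !tintS; apply: ge0_le_integral => //.
- by move=> x _; apply: tint_ge0.
- exact: measurable_tint_cons.
- exact: measurable_tint_cons.
- by move=> x _; apply: IH => //; exact: measurable_cons_r.
Qed.

Lemma tintD P n (g1 g2 : n.-tuple T -> \bar R) :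
  (forall t, 0 <= g1 t) -> measurable_fun setT g1 ->
  (forall t, 0 <= g2 t) -> measurable_fun setT g2 ->
  tint P (fun t => g1 t + g2 t) = tint P g1 + tint P g2.
Proof.
elim: n P g1 g2 => [//|n IH] P g1 g2 g10 mg1 g20 mg2.
rewrite !tintS -ge0_integralD //.
- apply: eq_integral => x _; rewrite IH //; exact: measurable_cons_r.
- by move=> x _; apply: tint_ge0.
- exact: measurable_tint_cons.
- by move=> x _; apply: tint_ge0.
- exact: measurable_tint_cons.
Qed.

Lemma tintZl P n (k : R) (g : n.-tuple T -> \bar R) : (0 <= k)%R ->
  (forall t, 0 <= g t) -> measurable_fun setT g ->
  tint P (fun t => k%:E * g t) = k%:E * tint P g.
Proof.
elim: n P g => [//|n IH] P g k0 g0 mg.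
rewrite !tintS -ge0_integralZl_EFin //.
- apply: eq_integral => x _; rewrite IH //; exact: measurable_cons_r.
- by move=> x _; apply: tint_ge0.
- exact: measurable_tint_cons.
Qed.

Lemma tint_cst P n (k : R) : tint P (fun _ : n.-tuple T => k%:E) = k%:E.
Proof.
elim: n P => [//|n IH] P; rewrite tintS.
by under eq_integral do rewrite IH; rewrite integral_cst //; rewrite [X in _ * X](@probability_setT _ _ _ (P 0%N)) mule1.
Qed.

(** A null set of values stays negligible when the coordinates are integrated in turn. This serves
    the means 0 and 1, where the relative entropy can be infinite at exceptional samples. *)
Lemma ae_tint_le P n (S : set T) (C : R) (g : n.-tuple T -> \bar R) : (0 <= C)%R ->
  (forall i, {ae P i, forall x, S x}) ->
  (forall t, 0 <= g t) -> measurable_fun setT g ->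
  (forall t, (forall i, S (tnth t i)) -> g t <= C%:E) -> tint P g <= C%:E.
Proof.
move=> C0; elim: n P g => [|n IH] P g aeS g0 mg gC; first by apply: gC => -[].
rewrite tintS -[leRHS]mule1 -(probability_setT (P 0%N)) -integral_cst //.
apply: ae_ge0_le_integral => //.
- by move=> x _; apply: tint_ge0.
- exact: measurable_tint_cons.
- have := aeS 0%N; apply: filterS => x Sx _.
  apply: IH => //; first exact: measurable_cons_r.
  move=> t St; apply: gC => i.
  by case: (unliftP ord0 i) => [j ->|->]; rewrite ?tnthS ?tnth0.
Qed.

End basic.

(** * Tonelli's theorem for two iterated integrals *)

Section swap.
Context {d1 d2} {T : measurableType d1} {U : measurableType d2}.

Lemma integral_tint (mu : probability T R) (Q : nat -> probability U R) m
    (G : T -> m.-tuple U -> \bar R) :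
  (forall x u, 0 <= G x u) ->
  measurable_fun setT (fun p : T * m.-tuple U => G p.1 p.2) ->
  \int[mu]_x tint Q (G x) = tint Q (fun u => \int[mu]_x G x u).
Proof.
elim: m Q G => [//|m IH] Q G G0 mG.
rewrite [RHS]tintS.
have mG2 : measurable_fun setT (fun p : (T * U) * m.-tuple U => G p.1.1 (cons_tuple p.1.2 p.2)).
  apply: (measurable_uncurry (u := fun p : T * U * m.-tuple U => p.1.1)
    (v := fun p => cons_tuple p.1.2 p.2) mG); first exact: measurableT_comp.
  by apply: measurable_cons => //; exact: measurableT_comp.
rewrite (@fubini_tonelli _ _ _ _ _ mu (Q 0%N)
  (fun p => tint (fun i => Q i.+1) (fun u => G p.1 (cons_tuple p.2 u)))) /=.
- apply: eq_integral => y _; apply: IH => //.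
  apply: (measurable_uncurry (u := fst)
    (v := fun p => cons_tuple y p.2) mG) => //.
  by apply: (measurable_cons (f := fun=> y) (g := snd)).
- exact: (measurable_tint _ (fun p u => G0 p.1 (cons_tuple p.2 u))).
- by move=> p; apply: tint_ge0.
Qed.

Lemma tint_swap (P : nat -> probability T R) (Q : nat -> probability U R) n m
    (G : n.-tuple T -> m.-tuple U -> \bar R) :
  (forall t u, 0 <= G t u) ->
  measurable_fun setT (fun p : n.-tuple T * m.-tuple U => G p.1 p.2) ->
  tint P (fun t => tint Q (G t)) = tint Q (fun u => tint P (fun t => G t u)).
Proof.
elim: n P G => [//|n IH] P G G0 mG.
rewrite [LHS]tintS.
transitivity (\int[P 0%N]_x tint Q (fun u => tint (fun i => P i.+1)
    (fun t => G (cons_tuple x t) u))).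
  apply: eq_integral => x _; apply: IH => //.
  apply: (measurable_uncurry (u := fun p : n.-tuple T * m.-tuple U =>
    cons_tuple x p.1) (v := snd) mG) => //.
  by apply: (measurable_cons (f := fun=> x) (g := fst)).
rewrite integral_tint //.
  by move=> x u; apply: tint_ge0.
apply: (@measurable_tint _ _ _ (T * m.-tuple U)%type _ _
  (fun p t => G (cons_tuple p.1 t) p.2)) => //.
apply: (measurable_uncurry (u := fun p : T * m.-tuple U * n.-tuple T =>
  cons_tuple p.1.1 p.2) (v := fun p => p.1.2) mG); last exact: measurableT_comp.
by apply: measurable_cons => //; exact: measurableT_comp.
Qed.

End swap.
End iterated_integral.

(** * Gaussian densities *)

Section density.
Context {R : realType} {d} {T : measurableType d}.
Variables (mu nu : {measure set T -> \bar R}) (f : T -> R).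
Hypothesis f0 : forall x, 0 <= f x.
Hypothesis mf : measurable_fun setT f.
Hypothesis nuE : forall A, measurable A -> nu A = (\int[mu]_(x in A) (f x)%:E)%E.
Local Open Scope ereal_scope.
Import HBNNSimple.

Let integral_density_nnsfun (h : {nnsfun T >-> R}) :
  \int[nu]_x (h x)%:E = \int[mu]_x ((h x)%:E * (f x)%:E).
Proof.
rewrite integralT_nnsfun sintegralE.
under [RHS]eq_integral => x _.
  rewrite fimfunE -fsumEFin// ge0_mule_fsuml; last first.
    by move=> r; rewrite EFinM nnfun_muleindic_ge0.
  over.
rewrite ge0_integral_fsum//; last 2 first.
  - move=> r; apply: emeasurable_funM; last exact/measurable_EFinP.
    by apply/measurable_EFinP; do 2 apply/measurableT_comp => //.
  - by move=> r x _; apply: mule_ge0; rewrite ?EFinM ?nnfun_muleindic_ge0 ?lee_fin.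
apply: eq_fsbigr => r; rewrite inE => -[x _ <-].
under eq_integral do rewrite EFinM -muleA.
rewrite ge0_integralZl_EFin//; last 2 first.
  - by move=> y _; rewrite mule_ge0 ?lee_fin.
  - apply: emeasurable_funM; last exact/measurable_EFinP.
    by apply/measurable_EFinP.
congr (_ * _); rewrite nuE//.
rewrite [LHS]integral_mkcond; apply: eq_integral => y _.
by rewrite patchE indicE; case: (y \in _); rewrite ?mul1e ?mul0e.
Qed.

Lemma ge0_integral_density (g : T -> \bar R) :
  (forall x, 0 <= g x) -> measurable_fun setT g ->
  \int[nu]_x g x = \int[mu]_x (g x * (f x)%:E).
Proof.
move=> g0 mg; pose g_ := nnsfun_approx measurableT mg.
have ndg x m n : (m <= n)%N -> (g_ m x <= g_ n x)%R.
  by move=> mn; exact/lefP/nd_nnsfun_approx.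
transitivity (limn (fun n => \int[nu]_x (g_ n x)%:E)).
  rewrite -monotone_convergence//=.
  - apply: eq_integral => x _; apply/esym/cvg_lim => //=.
    exact: cvg_nnsfun_approx.
  - by move=> n; apply: measurableT_comp.
  - by move=> n x _; rewrite lee_fin.
  - by move=> x _ a b ab; rewrite lee_fin ndg.
under eq_fun do rewrite integral_density_nnsfun.
rewrite -monotone_convergence//=.
- apply: eq_integral => x _; apply/cvg_lim => //=.
  apply: cvgeZr => //; exact: cvg_nnsfun_approx.
- by move=> n; apply: emeasurable_funM; apply/measurable_EFinP.
- by move=> n x _; rewrite mule_ge0 ?lee_fin.
- by move=> x _ a b ab; rewrite lee_wpmul2r ?lee_fin ?ndg.
Qed.

End density.

(** * Likelihood ratios of Gaussians with equal variance *)

Section gaussian_shift.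
Context {R : realType}.
Implicit Types (m a s : R).

(* The log-density of N(m, s^2) with respect to N(a, s^2). *)
Definition gauss_llr s m a (h : R) : R :=
  (m - a) * (h - a) / s ^+ 2 - (m - a) ^+ 2 / (s ^+ 2 *+ 2).

Lemma measurable_gauss_llr s a {dV} {V : measurableType dV} (u v : V -> R) :
  measurable_fun setT u -> measurable_fun setT v ->
  measurable_fun setT (fun z => gauss_llr s (u z) a (v z)).
Proof.
move=> mu mv; apply: measurable_funB; apply: measurable_funM => //.
  by apply: measurable_funM; apply: measurable_funB.
by apply: measurable_funX; apply: measurable_funB.
Qed.

Lemma normal_pdf_shift s m a (h : R) : s != 0 ->
  normal_pdf m s h = normal_pdf a s h * expR (gauss_llr s m a h).
Proof.
move=> s0; rewrite !normal_pdfE// -mulrA; congr (_ * _).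
rewrite /normal_fun -expRD; congr expR; rewrite /gauss_llr.
by field.
Qed.

Lemma integral_normal_shift s m a (g : measurableTypeR R -> \bar R) : s != 0 ->
  (forall h, (0 <= g h)%E) -> measurable_fun setT g ->
  (\int[normal_prob m s]_h g h =
   \int[normal_prob a s]_h ((expR (gauss_llr s m a h))%:E * g h))%E.
Proof.
move=> s0 g0 mg.
have mr : measurable_fun setT (fun h : measurableTypeR R => expR (gauss_llr s m a h)).
  by apply: measurableT_comp => //; exact: measurable_gauss_llr.
rewrite (@ge0_integral_density _ _ _ lebesgue_measure _ (normal_pdf m s))//; last first.
  exact: measurable_normal_pdf.
  exact: normal_pdf_ge0.
rewrite [RHS](@ge0_integral_density _ _ _ lebesgue_measure _ (normal_pdf a s))//.
- apply: eq_integral => h _.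
  by rewrite (normal_pdf_shift m a h s0) mulrC EFinM muleA (muleC (g h)).
- exact: normal_pdf_ge0.
- exact: measurable_normal_pdf.
- by move=> h; rewrite mule_ge0 ?lee_fin ?expR_ge0.
- by apply: emeasurable_funM => //; exact/measurable_EFinP.
Qed.

Definition gauss_lr s n (m a : nat -> R) (h : n.-tuple R) : R :=
  expR (\sum_(i < n) gauss_llr s (m i) (a i) (tnth h i)).

Lemma measurable_gauss_lr s n (a : nat -> R) {dV} {V : measurableType dV}
    (u : V -> nat -> R) (v : V -> n.-tuple (measurableTypeR R)) :
  (forall i : 'I_n, measurable_fun setT (fun z => u z i)) -> measurable_fun setT v ->
  measurable_fun setT (fun z => gauss_lr s (u z) a (v z)).
Proof.
move=> mu mv; apply: measurableT_comp => //.
apply: measurable_sum => i; apply: measurable_gauss_llr => //.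
exact: (measurableT_comp (measurable_tnth i) mv).
Qed.

Definition normals s (m : nat -> R) (i : nat) : probability (measurableTypeR R) R :=
  normal_prob (m i) s.

Lemma tint_normal_shift s n (m a : nat -> R)
    (g : n.-tuple (measurableTypeR R) -> \bar R) : s != 0 ->
  (forall h, (0 <= g h)%E) -> measurable_fun setT g ->
  (tint (normals s m) g = tint (normals s a) (fun h => (gauss_lr s m a h)%:E * g h))%E.
Proof.
move=> s0; elim: n m a g => [|n IH] m a g g0 mg.
  by rewrite /tint /= /gauss_lr big_ord0 expR0 mul1e.
rewrite !tintS (integral_normal_shift (m 0%N) (a 0%N))//; last first.
  exact: measurable_tint_cons.
  by move=> h; exact: tint_ge0.
apply: eq_integral => x _.
rewrite (IH (fun i => m i.+1) (fun i => a i.+1))//; last exact: measurable_cons_r.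
have mlr : measurable_fun setT
    (fun h : n.-tuple (measurableTypeR R) => gauss_lr s (fun i => m i.+1) (fun i => a i.+1) h).
  exact: (measurable_gauss_lr s (fun i => a i.+1) (u := fun=> fun i => m i.+1)).
rewrite -tintZl ?expR_ge0//.
- apply: eq_tint => t; rewrite muleA -EFinM /gauss_lr -expRD big_ord_recl tnth0.
  by congr ((expR (_ + _))%:E * _)%E; apply: eq_bigr => i _; rewrite tnthS.
- by move=> t; rewrite mule_ge0 ?lee_fin ?expR_ge0.
- apply: emeasurable_funM; first exact/measurable_EFinP.
  exact: measurable_cons_r.
Qed.

(** Completing the square: the squared ratio of [m] to [a] is exp (|m - a|^2 / s^2) times the ratio
    of [2 * m - a] to [a], which integrates to one. *)
Lemma tint_gauss_lr_sqr s n (m a : nat -> R) : s != 0 ->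
  (tint (normals s a) (fun h : n.-tuple (measurableTypeR R) =>
     (gauss_lr s m a h ^+ 2)%:E) =
   (expR ((\sum_(i < n) (m i - a i) ^+ 2) / s ^+ 2))%:E)%E.
Proof.
move=> s0; set c := expR _.
transitivity (tint (normals s (fun i => 2 * m i - a i))
  (fun _ : n.-tuple (measurableTypeR R) => c%:E)); last exact: tint_cst.
rewrite (tint_normal_shift (fun i => 2 * m i - a i) a)//; last first.
  by move=> h; rewrite lee_fin expR_ge0.
apply: eq_tint => h; rewrite -EFinM /gauss_lr /c; congr EFin.
rewrite -expRM_natl -expRD mulr_sumr mulr_suml -big_split /=; congr expR.
apply: eq_bigr => i _; rewrite /gauss_llr; by field.
Qed.

End gaussian_shift.

(** * Inequalities for the exponential function *)

Section exponential_inequalities.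
Context {R : realType}.
Implicit Types (x s p : R).

Lemma ge0_of_is_derive (f f' : R -> R) : (forall x, is_derive x 1 f (f' x)) ->
  (forall x, 0 < x -> 0 <= f' x) -> 0 <= f 0 -> forall x, 0 <= x -> 0 <= f x.
Proof.
move=> fd f'0 f0 x x0; apply: (le_trans f0).
apply: (@ger0_derive1_ndecry _ f 0) => //.
- by move=> y; rewrite in_itv/= andbT => y0; rewrite derive1E (@derive_val _ _ _ _ _ _ _ (fd y)) f'0.
- apply: continuous_subspaceT => y.
  apply: differentiable_continuous; apply/derivable1_diffP.
  exact: (@ex_derive _ _ _ _ _ _ _ (fd y)).
Qed.

(** The derivation rules are restated for functions written pointwise, so that each derivative below
    is an explicit term, matched by [ring], [field] or [lra]. *)
Let dC (c x : R) : is_derive x 1 (fun=> c) 0 := is_derive_cst c x 1.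

Let dI x : is_derive x 1 (fun y : R => y) 1 := is_derive_id x 1.

Let dexp x : is_derive x 1 (fun y : R => expR y) (expR x) := is_derive_expR x.

Let dD (f g : R -> R) x (f' g' : R) : is_derive x 1 f f' -> is_derive x 1 g g' ->
  is_derive x 1 (fun y => f y + g y) (f' + g').
Proof. exact: is_deriveD. Qed.

Let dN (f : R -> R) x (f' : R) : is_derive x 1 f f' ->
  is_derive x 1 (fun y => - f y) (- f').
Proof. exact: is_deriveN. Qed.

Let dM (f g : R -> R) x (f' g' : R) : is_derive x 1 f f' -> is_derive x 1 g g' ->
  is_derive x 1 (fun y => f y * g y) (f x * g' + g x * f').
Proof. exact: is_deriveM. Qed.

Let dV (f : R -> R) x (f' : R) : f x != 0 -> is_derive x 1 f f' ->
  is_derive x 1 (fun y => (f y)^-1) (- (f x) ^- 2 * f').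
Proof. exact: is_deriveV. Qed.

(** Divided by 2 - x, the right side is the (1,1) Pade approximant of exp, that is 1 + x + x^2 / (2
    - x): the shape behind Bernstein's inequality. The difference has derivative 1 - (1 - x) e^x,
    nonnegative since e^(-x) >= 1 - x. *)
Lemma expR_le_pade x : 0 <= x -> (2 - x) * expR x <= 2 + x.
Proof.
move=> x0; rewrite -subr_ge0.
pose f (y : R) := (2 + y) + - ((2 + - y) * expR y).
have fd (y : R) : is_derive y 1 f (1 - expR y + y * expR y).
  apply: (is_derive_eq (dD (dD (dC 2 y) (dI y))
    (dN (dM (dD (dC 2 y) (dN (dI y))) (dexp y))))).
  ring.
apply: (ge0_of_is_derive fd _ _ x0) => [y y0|].
- have := expR_ge1Dx (- y); rewrite expRN => h.
  have ey := expR_gt0 y.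
  have : (1 - y) * expR y <= 1 by rewrite -ler_pdivlMr// div1r.
  lra.
- by rewrite /f expR0; lra.
Qed.

Lemma expR_le_quad_pos x s : 0 <= x -> x <= s -> s < 2 ->
  expR x <= 1 + x + x ^+ 2 / (2 - s).
Proof.
move=> x0 xs s2; have h := expR_le_pade x0.
have x2 : 0 < 2 - x by lra.
apply: (@le_trans _ _ (1 + x + x ^+ 2 / (2 - x))).
  rewrite -(ler_pM2l x2); apply: (le_trans h).
  by rewrite le_eqVlt; apply/orP; left; apply/eqP; field; lra.
rewrite lerD2l ler_wpM2l ?sqr_ge0// lef_pV2 ?posrE; lra.
Qed.

Lemma expR_ge_quad x : 0 <= x -> 1 + x + x ^+ 2 / 2 <= expR x.
Proof.
move=> x0; rewrite -subr_ge0.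
pose f (y : R) := expR y + - (1 + y + 2^-1 * (y * y)).
have -> : expR x - (1 + x + x ^+ 2 / 2) = f x by rewrite /f; ring.
have fd (y : R) : is_derive y 1 f (expR y - (1 + y)).
  apply: (is_derive_eq (dD (dexp y) (dN (dD (dD (dC 1 y) (dI y))
    (dM (dC 2^-1 y) (dM (dI y) (dI y))))))).
  lra.
apply: (ge0_of_is_derive fd _ _ x0) => [y _|].
- by rewrite subr_ge0; exact: expR_ge1Dx.
- by rewrite /f expR0; lra.
Qed.

Lemma expR_le_quad_neg x : x <= 0 -> expR x <= 1 + x + x ^+ 2 / 2.
Proof.
move=> x0; have h := @expR_ge_quad (- x); rewrite -[x]opprK expRN.
have {}h := h ltac:(lra); set y := - x in h *.
have y0 : 0 <= y by rewrite /y; lra.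
have e0 := expR_gt0 y.
rewrite -div1r ler_pdivrMr //.
(* The two quadratic Taylor polynomials have product 1 + y^4 / 4 >= 1, so a lower bound for exp y
   becomes an upper bound for exp (- y). *)
apply: (@le_trans _ _ ((1 - y + (- y) ^+ 2 / 2) * (1 + y + y ^+ 2 / 2))).
  have -> : (1 - y + (- y) ^+ 2 / 2) * (1 + y + y ^+ 2 / 2) = 1 + (y ^+ 2) ^+ 2 / 4 by field.
  by have := sqr_ge0 (y ^+ 2); lra.
apply: ler_wpM2l => //.
have -> : 1 - y + (- y) ^+ 2 / 2 = ((1 - y) ^+ 2 + 1) / 2 by field.
by have := sqr_ge0 (1 - y); lra.
Qed.

Lemma expR_le_quad x s : 0 <= s -> x <= s -> s < 2 ->
  expR x <= 1 + x + x ^+ 2 / (2 - s).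
Proof.
move=> s0 xs s2; have [x0|/ltW x0] := leP 0 x; first exact: expR_le_quad_pos.
apply: (le_trans (expR_le_quad_neg x0)).
rewrite lerD2l ler_wpM2l ?sqr_ge0// lef_pV2 ?posrE; lra.
Qed.

Lemma expR_le_quad1 x : x <= 1 -> expR x <= 1 + x + x ^+ 2.
Proof.
move=> x1; apply: (le_trans (@expR_le_quad x 1 _ x1 _)) => //; first lra.
by rewrite (_ : 2 - 1 = 1) ?divr1//; lra.
Qed.

(** Serves the case of zero variance, where the exponent can reach 2 and [expR_le_quad] does not
    apply. The quadratic term then integrates to zero, so the size of the constant 10 is
    immaterial. *)
Lemma expR_le_quad2 x : x <= 2 -> expR x <= 1 + x + 10 * x ^+ 2.
Proof.
move=> x2; have [x1|x1] := leP x 1.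
  by apply: (le_trans (expR_le_quad1 x1)); have := sqr_ge0 x; lra.
have e1 : expR 1 <= (3 : R) by have := @expR_le_quad1 1 (lexx _); lra.
have : expR x <= expR 1 * expR 1 by rewrite -expRD ler_expR; lra.
have := expR_gt0 (1 : R); have : 1 <= x ^+ 2 by rewrite exprn_ege1 ?ltW.
nra.
Qed.

Lemma hoeffding_bernoulli_pos p s : 0 <= p <= 1 -> 0 <= s ->
  1 - p + p * expR s <= expR (p * s + s ^+ 2 / 8).
Proof.
move=> /andP[p0 p1] s0.
pose D (y : R) := (1 - p) + p * expR y.
have Dgt0 y : 0 < D y.
  rewrite /D; have e0 := expR_gt0 y.
  have [->|pn0] := eqVneq p 0; first lra.
  have : 0 < p * expR y by rewrite mulr_gt0// lt_neqAle eq_sym pn0.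
  lra.
have Dn0 y : D y != 0 by exact: lt0r_neq0.
have dDD (y : R) : is_derive y 1 D (p * expR y).
  by apply: (is_derive_eq (dD (dC (1 - p) y) (dM (dC p y) (dexp y)))); ring.
(* [k] is the derivative of p y + y^2 / 8 - ln (D y). Its own derivative is 1/4 - q (1 - q) >= 0,
   with q the mean of the exponentially tilted Bernoulli law. *)
pose k (y : R) := p + 4^-1 * y + - ((p * expR y) * (D y)^-1).
have dk (y : R) : is_derive y 1 k
    (4^-1 - (p * expR y / D y) * (1 - p * expR y / D y)).
  apply: (is_derive_eq (dD (dD (dC p y) (dM (dC 4^-1 y) (dI y)))
    (dN (dM (dM (dC p y) (dexp y)) (dV (Dn0 y) (dDD y)))))).
  move: (Dn0 y); move: (D y) (expR y) => Dy e Dy0; by field.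
have k0 y : 0 <= y -> 0 <= k y.
  move=> y0; apply: (ge0_of_is_derive dk _ _ y0) => [z _|].
  - set q := p * _ / _.
    by have := sqr_ge0 (q - 2^-1); rewrite sqrrB; lra.
  - by rewrite /k /D expR0 mulr1 subrK invr1; lra.
pose E (y : R) := - (p * y + 8^-1 * (y * y)).
have dE (y : R) : is_derive y 1 E (- (p + y / 4)).
  apply: (is_derive_eq (dN (dD (dM (dC p y) (dI y))
    (dM (dC 8^-1 y) (dM (dI y) (dI y)))))); lra.
(* [F] compares [D] with its bound without taking a logarithm; its derivative carries the sign of
   [k]. *)
pose F (y : R) := 1 + - (D y * expR (E y)).
have dF (y : R) : is_derive y 1 F (expR (E y) * D y * k y).
  apply: (is_derive_eq (dD (dC 1 y) (dN (dM (dDD y)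
    (is_derive1_comp (dexp (E y)) (dE y)))))).
  rewrite /k /comp /=; move: (Dn0 y); move: (D y) (expR y) (expR (E y)) => Dy e eE Dy0.
  by field.
have : 0 <= F s.
  apply: (ge0_of_is_derive dF _ _ s0) => [z z0|].
  - by rewrite !mulr_ge0 ?expR_ge0 ?k0 ?ltW.
  - by rewrite /F /E /D !mulr0 addr0 oppr0 expR0; lra.
rewrite /F subr_ge0 /E expRN -ler_pdivlMr ?invr_gt0 ?expR_gt0//.
rewrite invrK mul1r /D (_ : p * s + 8^-1 * (s * s) = p * s + s ^+ 2 / 8)//.
ring.
Qed.

(** Exchanging the two outcomes turns (p, s) into (1 - p, - s), up to a factor e^s. *)
Lemma hoeffding_bernoulli p s : 0 <= p <= 1 ->
  1 - p + p * expR s <= expR (p * s + s ^+ 2 / 8).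
Proof.
move=> p01; have [s0|/ltW s0] := leP 0 s; first exact: hoeffding_bernoulli_pos.
have q01 : 0 <= 1 - p <= 1 by lra.
have := @hoeffding_bernoulli_pos (1 - p) (- s) q01 ltac:(lra).
rewrite -(ler_pM2l (expR_gt0 s)) -expRD sqrrN.
rewrite (_ : s + _ = p * s + s ^+ 2 / 8); last by field.
apply: le_trans; rewrite mulrDr mulrCA -expRD subrr expR0.
by rewrite le_eqVlt; apply/orP; left; apply/eqP; ring.
Qed.

End exponential_inequalities.

(** * Abel's identity and the Maurer sum *)

Section abel_identity.
Context {R : numFieldType}.
Implicit Types (p q : {poly R}).

Lemma deriv_eq_poly p q (a : R) : p^`() = q^`() -> p.[a] = q.[a] -> p = q.
Proof.
move=> pq pqa; apply/eqP; rewrite -subr_eq0; set r := p - q.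
have rd : r^`() = 0 by rewrite derivB pq subrr.
have rC : r = (r`_0)%:P.
  apply/polyP => -[|i]; rewrite coefC//=.
  have := congr1 (fun u : {poly R} => u`_i) rd; rewrite coef_deriv coef0.
  by move/eqP; rewrite mulrn_eq0 /= => /eqP.
have : r.[a] = 0 by rewrite hornerD hornerN pqa subrr.
by rewrite rC hornerC => ->.
Qed.

Lemma comp_polyXn p q m : p ^+ m \Po q = (p \Po q) ^+ m.
Proof.
elim: m => [|m IH]; first by rewrite !expr0 comp_polyC.
by rewrite !exprS comp_polyM IH.
Qed.

(** The n-th backward difference of 'X^m. *)
Definition alt_power_sum n m : {poly R} :=
  \sum_(k < n.+1) ((-1) ^+ k * 'C(n, k)%:R) *: ('X - (k%:R)%:P) ^+ m.

Lemma deriv_alt_power_sum n m :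
  (alt_power_sum n m.+1)^`() = (m.+1)%:R *: alt_power_sum n m.
Proof.
rewrite /alt_power_sum linear_sum /= scaler_sumr; apply: eq_bigr => k _.
by rewrite derivZ deriv_exp derivXsubC mul1r scaler_nat scalerMnr.
Qed.

Lemma alt_power_sumS n m :
  alt_power_sum n.+1 m = alt_power_sum n m - (alt_power_sum n m \Po ('X - 1%:P)).
Proof.
rewrite /alt_power_sum big_ord_recl /= bin0 expr0 mul1r scale1r.
under eq_bigr => i _ do rewrite /= /bump /= add1n binS natrD mulrDr scalerDl.
rewrite big_split /= big_ord_recr /= bin_small// mulr0 scale0r addr0.
rewrite addrA; congr (_ + _).
  rewrite [RHS]big_ord_recl /= bin0 expr0 mul1r scale1r; congr (_ + _).
rewrite rmorph_sum -sumrN; apply: eq_bigr => i _ /=.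
rewrite exprS mulN1r mulNr scaleNr comp_polyZ comp_polyXn comp_polyB.
rewrite comp_polyX comp_polyC; congr (- (_ *: _ ^+ _)).
by rewrite -addn1 natrD polyCD -[in RHS]addrA -opprD [1%:P + _]addrC.
Qed.

(** By induction [alt_power_sum n n.+1] has constant derivative (n+1)!, so it is affine; one more
    difference leaves its slope. *)
Lemma alt_power_sum_fact n : alt_power_sum n n = (n`!%:R)%:P.
Proof.
elim: n => [|n IH].
  by rewrite /alt_power_sum big_ord1 /= bin0 expr0 mulr1 scale1r expr0.
have -> : alt_power_sum n.+1 n.+1 = ((n.+1)`!%:R)%:P => //.
set c := (n.+1)`!%:R; set s := alt_power_sum n n.+1.
have sE : s = c *: 'X + (s.[0])%:P.
  apply: (@deriv_eq_poly _ _ 0); last by rewrite !hornerE ?mulr0 ?add0r.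
  rewrite deriv_alt_power_sum IH derivD derivZ derivX derivC addr0.
  by rewrite /c factS natrM -mul_polyC -polyCM alg_polyC.
rewrite alt_power_sumS -/s sE comp_polyD comp_polyZ comp_polyX comp_polyC.
by rewrite opprD addrACA subrr addr0 -scalerBr opprB addrC subrK alg_polyC.
Qed.

(** As polynomials in y both sides satisfy p_(n+1)' = (n+1) p_n, so values at 0 decide. There the
    left side is the (n+1)-st difference of 'X^(n+1), the right side keeps only its last term, and
    both are (n+1)!. *)
Lemma abel_identity n (y : R) :
  \sum_(k < n.+1) 'C(n, k)%:R * k%:R ^+ k * (y - k%:R) ^+ (n - k) =
  \sum_(j < n.+1) (n ^_ j)%:R * y ^+ (n - j).
Proof.
pose P m : {poly R} := \sum_(k < m.+1)
  ('C(m, k)%:R * k%:R ^+ k) *: ('X - (k%:R)%:P) ^+ (m - k).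
pose Q m : {poly R} := \sum_(j < m.+1) (m ^_ j)%:R *: 'X ^+ (m - j).
suff PQ : P n = Q n.
  have := congr1 (horner^~ y) PQ; rewrite /P /Q !horner_sum => PQy.
  transitivity (\sum_(k < n.+1) (('C(n, k)%:R * k%:R ^+ k) *:
      ('X - (k%:R)%:P) ^+ (n - k)).[y]).
    by apply: eq_bigr => k _; rewrite !hornerE.
  by rewrite PQy; apply: eq_bigr => k _; rewrite !hornerE ?hornerXn.
elim: n => [|n IH].
  by rewrite /P /Q !big_ord1 /= bin0 ffactn0 !expr0 mulr1.
have dP : (P n.+1)^`() = n.+1%:R *: P n.
  rewrite /P linear_sum /= big_ord_recr /= subnn expr0 derivZ (derivC 1) scaler0 addr0.
  rewrite scaler_sumr; apply: eq_bigr => k _.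
  have kn : (k <= n)%N by rewrite -ltnS.
  rewrite derivZ subSn// deriv_exp derivXsubC mul1r -[X in _ *: X]scaler_nat !scalerA /=.
  congr (_ *: _); rewrite [RHS]mulrA mulrAC; congr (_ * _).
  by rewrite -!natrM; congr (_%:R); rewrite mulnC -subSn// mul_bin_down.
have dQ : (Q n.+1)^`() = n.+1%:R *: Q n.
  rewrite /Q linear_sum /= big_ord_recr /= subnn expr0 derivZ (derivC 1) scaler0 addr0.
  rewrite scaler_sumr; apply: eq_bigr => k _.
  have kn : (k <= n)%N by rewrite -ltnS.
  rewrite derivZ subSn// derivXn -[X in _ *: X]scaler_nat !scalerA /=.
  congr (_ *: _); rewrite -!natrM; congr (_%:R).
  by rewrite -subSn// -ffactnSr ffactSS.
apply: (@deriv_eq_poly _ _ 0); first by rewrite dP dQ IH.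
transitivity ((n.+1)`!%:R : R).
  have := congr1 (horner^~ (0 : R)) (alt_power_sum_fact n.+1).
  rewrite hornerC => <-; rewrite /P /alt_power_sum !horner_sum.
  apply: eq_bigr => k _; rewrite !hornerE.
  have kn : (k <= n.+1)%N by rewrite -ltnS.
  have -> : (- k%:R : R) ^+ n.+1 = (-1) ^+ k * k%:R ^+ k * (- k%:R) ^+ (n.+1 - k).
    by rewrite -exprNn -exprD subnKC.
  move: (sqrr_sign R k).
  move: ('C(n.+1, k)%:R) ((-1) ^+ k) (k%:R ^+ k) ((- k%:R) ^+ _) => c e K z e2.
  by rewrite -[LHS]mul1r -e2; ring.
rewrite /Q horner_sum big_ord_recr /= subnn expr0 ffactnn big1 ?add0r.
  by rewrite !hornerE.
move=> k _; rewrite hornerZ hornerXn expr0n subn_eq0 leqNgt ltn_ord /=.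
by rewrite mulr0.
Qed.
End abel_identity.

(** * The bound on Maurer's sum *)

Section maurer_sum.
Context {R : realType}.

Lemma sum_nat_ord m : \sum_(i < m) (i%:R : R) = m%:R * (m%:R - 1) / 2.
Proof.
elim: m => [|m IH]; first by rewrite big_ord0 mul0r mul0r.
by rewrite big_ord_recr /= IH -addn1 natrD; field.
Qed.

(* The weights t_j = n^_j / n^j satisfy 0 <= t_j <= 1 and sum_j j t_j = n,
   since j t_j = n (t_j - t_(j+1)); hence the bound, using
   t_j <= (j/m) t_j + max(0, 1 - j/m) with m just above sqrt n. *)
Lemma sum_ffact_le n : (3 < n)%N ->
  \sum_(j < n.+1) (n ^_ j)%:R / n%:R ^+ j <= 2 * Num.sqrt n%:R :> R.
Proof.
move=> n3; set s := Num.sqrt n%:R.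
have nR0 : (0 : R) < n%:R by rewrite ltr0n (leq_trans _ n3).
have nn0 : n%:R != 0 :> R by exact: lt0r_neq0.
have ss : s ^+ 2 = n%:R by rewrite sqr_sqrtr// ltW.
have s2 : 2 <= s.
  rewrite -(@ler_pXn2r _ 2) ?nnegrE ?sqrtr_ge0// ss -natrX ler_nat.
  exact: leq_trans n3.
pose t j : R := (n ^_ j)%:R / n%:R ^+ j.
have t0 j : 0 <= t j by rewrite divr_ge0 ?exprn_ge0 ?ler0n.
have tS j : (j <= n)%N -> t j.+1 = t j * (1 - j%:R / n%:R).
  by move=> jn; rewrite /t ffactnSr natrM natrB// exprSr; field; rewrite nn0 expf_neq0.
have t1 j : (j <= n.+1)%N -> t j <= 1.
  elim: j => [_|j IH jn]; first by rewrite /t ffactn0 expr0 divr1.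
  rewrite tS//; apply: (le_trans _ (IH (ltnW jn))).
  by rewrite ler_piMr// gerBl divr_ge0.
have jt j : (j <= n)%N -> j%:R * t j = n%:R * (t j - t j.+1).
  by move=> jn; rewrite tS//; field.
have sumjt : \sum_(j < n.+1) j%:R * t j = n%:R.
  transitivity (\sum_(0 <= j < n.+1) n%:R * (t j - t j.+1)).
    rewrite big_mkord; apply: eq_bigr => j _; apply: jt.
    by rewrite -ltnS.
  rewrite (@telescope_sumr_eq _ _ _ (fun j => - (n%:R * t j)))//; last first.
    by move=> j _; ring.
  by rewrite /t ffact_small// ffactn0 expr0; lra.
pose m := (Num.truncn s).+1.
have sm : s < m%:R by exact: truncnS_gt.
have ms : m%:R <= s + 1.
  by rewrite /m -addn1 natrD lerD2r truncn_le sqrtr_ge0.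
have mn : (m <= n.+1)%N.
  rewrite -(ler_nat R) (le_trans ms)// -[in leRHS]addn1 natrD lerD2r -ss expr2.
  by rewrite ler_peMr; lra.
have m0 : 0 < m%:R :> R by rewrite ltr0n.
have tle (j : 'I_n.+1) : t j <= m%:R^-1 * (j%:R * t j) + (if (j < m)%N then 1 - j%:R / m%:R else 0).
  have := t1 j (ltnW (ltn_ord j)); have := t0 j.
  case: ltnP => jm t0j t1j.
    have : 0 <= (1 - j%:R / m%:R) * (1 - t j).
      by rewrite mulr_ge0 ?subr_ge0// ler_pdivrMr// mul1r ler_nat ltnW.
    by lra.
  have : m%:R^-1 * m%:R * t j <= m%:R^-1 * j%:R * t j.
    apply: ler_wpM2r => //; apply: ler_wpM2l; last by rewrite ler_nat.
    by rewrite invr_ge0 ltW.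
  have -> : m%:R^-1 * m%:R = 1 :> R by apply: mulVf; exact: lt0r_neq0.
  lra.
(* The term n / m is at most sqrt n because m > sqrt n; the term (m + 1) / 2 is at most sqrt n / 2 +
   1, hence at most sqrt n because n >= 4. *)
apply: (@le_trans _ _ (n%:R / m%:R + (m%:R + 1) / 2)).
  apply: (le_trans (ler_sum _ (fun j _ => tle j))).
  rewrite big_split /= -mulr_sumr sumjt mulrC lerD2l.
  rewrite -big_mkcond /= -(big_ord_widen _ (fun j => 1 - j%:R / m%:R) mn).
  rewrite big_split /= sumr_const card_ord sumrN -mulr_suml sum_nat_ord.
  by rewrite le_eqVlt; apply/orP; left; apply/eqP; field; exact: lt0r_neq0.
have : n%:R / m%:R <= s.
  rewrite ler_pdivrMr// -ss expr2 ler_wpM2l ?sqrtr_ge0//; exact: ltW.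
by lra.
Qed.

(** After multiplication by n^n this is Abel's identity at y = n. *)
Lemma maurer_sum_le n : (3 < n)%N ->
  \sum_(k < n.+1) 'C(n, k)%:R * (k%:R / n%:R) ^+ k * (1 - k%:R / n%:R) ^+ (n - k)
  <= 2 * Num.sqrt n%:R :> R.
Proof.
move=> n3; have nn0 : n%:R != 0 :> R by rewrite pnatr_eq0 -lt0n (leq_trans _ n3).
apply: (le_trans _ (sum_ffact_le n3)); rewrite le_eqVlt; apply/orP; left; apply/eqP.
transitivity ((n%:R ^+ n)^-1 * \sum_(k < n.+1)
    'C(n, k)%:R * k%:R ^+ k * (n%:R - k%:R) ^+ (n - k) : R).
  rewrite mulr_sumr; apply: eq_bigr => k _.
  have kn : (k <= n)%N by rewrite -ltnS.
  rewrite (_ : 1 - k%:R / n%:R = (n%:R - k%:R) / n%:R); last by field.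
  rewrite !expr_div_n (_ : n%:R ^+ n = n%:R ^+ k * n%:R ^+ (n - k)); last first.
    by rewrite -exprD subnKC.
  field.
  by rewrite !expf_neq0.
rewrite abel_identity mulr_sumr; apply: eq_bigr => k _.
have kn : (k <= n)%N by rewrite -ltnS.
rewrite (_ : n%:R ^+ n = n%:R ^+ k * n%:R ^+ (n - k)); last first.
  by rewrite -exprD subnKC.
field.
by rewrite !expf_neq0.
Qed.

End maurer_sum.

(** * Bounded random variables *)

Section bounded_expectation.
Context {R : realType} {d} {X : measurableType d} (mu : probability X R).
Implicit Types (Y W : X -> R).

Local Notation Ex Y := (Rintegral mu setT Y).

Lemma bounded_integrable Y (M : R) : measurable_fun setT Y ->
  (forall x, `|Y x| <= M) -> mu.-integrable setT (EFin \o Y).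
Proof.
move=> mY YM; apply: measurable_bounded_integrable => //.
- by rewrite (le_lt_trans (probability_le1 mu measurableT)) ?ltry.
- exists M; split; first by rewrite num_real.
  by move=> N MN x _; apply: (le_trans (YM x)); exact: ltW.
Qed.

Lemma integral_bounded Y (M : R) : measurable_fun setT Y ->
  (forall x, `|Y x| <= M) -> (\int[mu]_x (Y x)%:E)%E = (Ex Y)%:E.
Proof.
move=> mY YM; rewrite /Rintegral fineK//.
exact: (integrable_fin_num _ (bounded_integrable mY YM)).
Qed.

Lemma integral_affine Y (M a b : R) : measurable_fun setT Y ->
  (forall x, `|Y x| <= M) ->
  (\int[mu]_x (a + b * Y x)%:E)%E = (a + b * Ex Y)%:E.
Proof.
move=> mY YM; have iY := bounded_integrable mY YM.
under eq_integral do rewrite EFinD EFinM.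
rewrite integralD//; last 2 first.
- exact: finite_measure_integrable_cst.
- exact: integrableZl.
rewrite integral_cst// [X in (_ * X)%E](@probability_setT _ _ _ mu) mule1.
by rewrite integralZl// (integral_bounded mY YM) -EFinM -EFinD.
Qed.

Lemma le_integral_EFin Y W : measurable_fun setT Y -> measurable_fun setT W ->
  (forall x, 0 <= Y x) -> (forall x, Y x <= W x) ->
  (\int[mu]_x (Y x)%:E <= \int[mu]_x (W x)%:E)%E.
Proof.
move=> mY mW Y0 YW; apply: ge0_le_integral.
- exact: measurableT.
- by move=> x _; rewrite lee_fin.
- exact/measurable_EFinP.
- exact/measurable_EFinP.
- by move=> x _; rewrite lee_fin.
Qed.

Lemma Ex_cst (a : R) : Ex (fun=> a) = a.
Proof.
rewrite /Rintegral integral_cst//.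
by rewrite [X in (_ * X)%E](@probability_setT _ _ _ mu) mule1.
Qed.

Lemma Ex_le_bound Y (M a : R) : measurable_fun setT Y ->
  (forall x, `|Y x| <= M) -> (forall x, Y x <= a) -> Ex Y <= a.
Proof.
move=> mY YM Ya; rewrite -(Ex_cst a).
apply: le_Rintegral => //; first exact: bounded_integrable YM.
exact: finite_measure_integrable_cst.
Qed.

Lemma Ex_ge_bound Y (M a : R) : measurable_fun setT Y ->
  (forall x, `|Y x| <= M) -> (forall x, a <= Y x) -> a <= Ex Y.
Proof.
move=> mY YM Ya; rewrite -(Ex_cst a).
apply: le_Rintegral => //; last exact: bounded_integrable YM.
exact: finite_measure_integrable_cst.
Qed.

(** Convexity from one tangent: the tangent of exp at s y bounds e^s and 1 from below, and the
    linear terms cancel under the weights y and 1 - y. *)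
Lemma expR_le_chord (s y : R) : 0 <= y <= 1 -> expR (s * y) <= 1 + (expR s - 1) * y.
Proof.
move=> /andP[y0 y1].
have e0 := expR_gt0 (s * y).
have h1 : expR (s * y) * (1 + (s - s * y)) <= expR s.
  rewrite -[in leRHS](subrKC (s * y) s) expRD ler_wpM2l ?expR_ge0//.
  exact: expR_ge1Dx.
have h2 : expR (s * y) * (1 - s * y) <= 1.
  rewrite -[leRHS]expR0 -[in leRHS](subrr (s * y)) expRD ler_wpM2l ?expR_ge0//.
  exact: expR_ge1Dx.
have := ler_wpM2l y0 h1.
have := @ler_wpM2l _ (1 - y) ltac:(lra) _ _ h2.
by lra.
Qed.

Lemma hoeffding01 Y (s : R) : measurable_fun setT Y -> (forall x, 0 <= Y x <= 1) ->
  (\int[mu]_x (expR (s * Y x))%:E <= (expR (s * Ex Y + s ^+ 2 / 8))%:E)%E.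
Proof.
move=> mY Y01.
have YM x : `|Y x| <= 1 by have /andP[? ?] := Y01 x; rewrite ger0_norm.
have p01 : 0 <= Ex Y <= 1.
  apply/andP; split; [apply: (Ex_ge_bound mY YM)|apply: (Ex_le_bound mY YM)] => x.
    by have /andP[] := Y01 x.
  by have /andP[] := Y01 x.
apply: (@le_trans _ _ (\int[mu]_x (1 + (expR s - 1) * Y x)%:E)%E).
  apply: le_integral_EFin.
  - by apply: measurableT_comp => //; apply: measurable_funM.
  - by apply: measurable_funD => //; exact: measurable_funM.
  - by move=> x; exact: expR_ge0.
  - by move=> x; exact: expR_le_chord.
rewrite (integral_affine 1 (expR s - 1) mY YM) lee_fin.
have := hoeffding_bernoulli s p01; rewrite (mulrC _ s).
by rewrite (_ : 1 - Ex Y + Ex Y * expR s = 1 + (expR s - 1) * Ex Y)//; ring.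
Qed.

Lemma hoeffding Y (t l w : R) : 0 < w -> measurable_fun setT Y ->
  (forall x, l <= Y x <= l + w) ->
  (\int[mu]_x (expR (t * Y x))%:E <= (expR (t * Ex Y + (t * w) ^+ 2 / 8))%:E)%E.
Proof.
move=> w0 mY Yl; have wn0 : w != 0 by exact: lt0r_neq0.
pose Z x := - l / w + w^-1 * Y x.
have mZ : measurable_fun setT Z.
  by apply: measurable_funD => //; exact: measurable_funM.
have Z01 x : 0 <= Z x <= 1.
  have -> : Z x = (Y x - l) / w by rewrite /Z; field.
  have /andP[? ?] := Yl x.
  by rewrite divr_ge0 ?subr_ge0 ?(ltW w0)//= ler_pdivrMr// mul1r; lra.
have YM x : `|Y x| <= `|l| + `|l + w|.
  have /andP[? ?] := Yl x; rewrite ler_norml.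
  have := ler_norm (l + w); have := ler_norm (- l); rewrite normrN.
  by have := normr_ge0 l; have := normr_ge0 (l + w); lra.
have EZ : Ex Z = - l / w + w^-1 * Ex Y.
  by rewrite /Rintegral /Z (integral_affine _ _ mY YM).
have -> : (\int[mu]_x (expR (t * Y x))%:E)%E =
    ((expR (t * l))%:E * \int[mu]_x (expR ((t * w) * Z x))%:E)%E.
  rewrite -ge0_integralZl_EFin ?expR_ge0//.
  - apply: eq_integral => x _; rewrite -EFinM -expRD /Z; congr (expR _)%:E.
    by field.
  - by apply/measurable_EFinP; apply: measurableT_comp => //; apply: measurable_funM.
apply: (@le_trans _ _ ((expR (t * l))%:E *
    (expR ((t * w) * Ex Z + (t * w) ^+ 2 / 8))%:E)%E).
  by apply: lee_pmul => //; rewrite ?lee_fin ?expR_ge0//; [exact: integral_ge0|exact: hoeffding01].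
rewrite -EFinM -expRD lee_fin ler_expR EZ le_eqVlt; apply/orP; left; apply/eqP.
by field.
Qed.

(* With [T = sqrt (E W)] the hypothesis forces [sqrt W] into [T - c, T + c]. *)
Lemma expectation_expR_le W (c D M : R) : 0 < c -> 12 <= D ->
  measurable_fun setT W -> (forall x, 0 <= W x <= M) ->
  (forall x y, Num.sqrt (W x) <= Num.sqrt (W y) + c) ->
  (\int[mu]_x (expR (W x / (c ^+ 2 * D)))%:E <=
   (expR (Ex W / (c ^+ 2 * (D - 4))))%:E)%E.
Proof.
move=> c0 D12 mW W0M Wc.
have W0 x : 0 <= W x by have /andP[] := W0M x.
have WM x : `|W x| <= M by rewrite ger0_norm//; have /andP[] := W0M x.
have E0 : 0 <= Ex W by exact: (Ex_ge_bound mW WM).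
set E := Ex W in E0 *; pose T := Num.sqrt E.
have T0 : 0 <= T by exact: sqrtr_ge0.
have TE : T ^+ 2 = E by rewrite sqr_sqrtr.
have sqW x : Num.sqrt (W x) ^+ 2 = W x by rewrite sqr_sqrtr.
have sW0 x : 0 <= Num.sqrt (W x) by exact: sqrtr_ge0.
(* Otherwise sqrt W would stay above some e > T everywhere, against E W = T^2. The lower bound is
   symmetric. *)
have Wub x : Num.sqrt (W x) <= T + c.
  rewrite leNgt; apply/negP => h; pose e := Num.sqrt (W x) - c.
  have eT : T < e by rewrite /e; lra.
  have : e ^+ 2 <= E.
    apply: (Ex_ge_bound mW WM) => y; rewrite -sqW.
    by rewrite ler_pXn2r ?nnegrE//; [have := Wc x y; rewrite /e; lra|lra].
  by rewrite -TE ler_pXn2r ?nnegrE//; lra.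
have Wlb x : T - c <= Num.sqrt (W x).
  rewrite leNgt; apply/negP => h; pose e := Num.sqrt (W x) + c.
  have e0 : 0 <= e by rewrite /e addr_ge0// ltW.
  have eT : e < T by rewrite /e; lra.
  have : E <= e ^+ 2.
    apply: (Ex_le_bound mW WM) => y; rewrite -sqW.
    by rewrite ler_pXn2r ?nnegrE//; have := Wc y x; rewrite /e; lra.
  by rewrite -TE ler_pXn2r ?nnegrE//; lra.
have c2 : 0 < c ^+ 2 by rewrite exprn_gt0.
have cn0 : c != 0 by exact: lt0r_neq0.
have D0 : 0 < D by lra.
have D4 : 0 < D - 4 by lra.
have Dn0 : D != 0 by exact: lt0r_neq0.
have D4n0 : D - 4 != 0 by exact: lt0r_neq0.
have [cT|Tc] := leP c T.
  (* Here [W] ranges in an interval of length (T + c)^2 - (T - c)^2 = 4 T c, so Hoeffding's error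
     term is proportional to T^2 = E W and can be absorbed: 1 / D becomes (D + 2) / D^2 <= 1 / (D -
     4). *)
  have w0 : 0 < 4 * T * c by rewrite mulr_gt0//; lra.
  have Wl x : (T - c) ^+ 2 <= W x <= (T - c) ^+ 2 + 4 * T * c.
    rewrite (_ : (T - c) ^+ 2 + 4 * T * c = (T + c) ^+ 2); last by ring.
    rewrite -sqW; have := Wlb x; have := Wub x => h1 h2.
    by rewrite !ler_pXn2r ?nnegrE ?h1 ?h2//; lra.
  have := hoeffding (c ^+ 2 * D)^-1 w0 mW Wl.
  under eq_integral do rewrite mulrC.
  move=> /le_trans; apply; rewrite lee_fin ler_expR -/E.
  have -> : (c ^+ 2 * D)^-1 * E + ((c ^+ 2 * D)^-1 * (4 * T * c)) ^+ 2 / 8 =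
      E / c ^+ 2 * ((D + 2) / D ^+ 2).
    by rewrite -TE; field; rewrite Dn0 cn0.
  rewrite (_ : E / (c ^+ 2 * (D - 4)) = E / c ^+ 2 * (D - 4)^-1); last first.
    by field; rewrite D4n0 cn0.
  rewrite ler_wpM2l ?divr_ge0 ?(ltW c2)//.
  rewrite ler_pdivrMr ?exprn_gt0// ler_pdivlMl//.
  by rewrite (_ : (D - 4) * (D + 2) = D ^+ 2 - (2 * D + 8)); [lra|ring].
(* For T < c the exponent z is at most 4 / D <= 1, and 1 + z + z^2 <= 1 + (1 + 4 / D) z keeps the
   error proportional to E W. The resulting (D + 4) / D^2 is what calls for a loss of 4. *)
have Wle x : W x <= 4 * c ^+ 2.
  rewrite -[leLHS]sqW (_ : 4 * c ^+ 2 = (2 * c) ^+ 2); last by ring.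
  by rewrite ler_pXn2r ?nnegrE//; have := Wub x; lra.
set b := (1 + 4 / D) / (c ^+ 2 * D).
apply: (@le_trans _ _ (\int[mu]_x (1 + b * W x)%:E)%E).
  apply: le_integral_EFin.
  - by apply: measurableT_comp => //; apply: measurable_funM.
  - by apply: measurable_funD => //; exact: measurable_funM.
  - by move=> x; exact: expR_ge0.
  - move=> x; set z := W x / _.
    have z4 : z <= 4 / D.
      rewrite /z (_ : 4 / D = 4 * c ^+ 2 / (c ^+ 2 * D)); last first.
        by field; rewrite Dn0 cn0.
      by rewrite ler_wpM2r// invr_ge0 mulr_ge0// ltW.
    have z0 : 0 <= z by rewrite divr_ge0// mulr_ge0// ltW.
    have D1 : 4 / D <= 1 by rewrite ler_pdivrMr//; lra.
    have -> : b * W x = z + 4 / D * z by rewrite /b /z; field; rewrite Dn0 cn0.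
    apply: (le_trans (expR_le_quad1 (le_trans z4 D1))).
    by have := ler_wpM2r z0 z4; rewrite -expr2; lra.
rewrite (integral_affine 1 b mW WM) lee_fin -/E.
apply: (le_trans (expR_ge1Dx _)); rewrite ler_expR.
rewrite (_ : b * E = E / c ^+ 2 * ((D + 4) / D ^+ 2)); last first.
  by rewrite /b; field; rewrite Dn0 cn0.
rewrite (_ : E / (c ^+ 2 * (D - 4)) = E / c ^+ 2 * (D - 4)^-1); last first.
  by field; rewrite D4n0 cn0.
rewrite ler_wpM2l ?divr_ge0 ?(ltW c2)//.
rewrite ler_pdivrMr ?exprn_gt0// ler_pdivlMl//.
by rewrite (_ : (D - 4) * (D + 4) = D ^+ 2 - 16); [lra|ring].
Qed.

End bounded_expectation.

(** * Concentration for bounded differences *)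

Section tuple_concentration.
Context {R : realType} {d} {X : measurableType d} (mu : probability X R).

Local Notation En g := (tint (fun=> mu) g).

Lemma tint_bounded n (P : nat -> probability X R) (g : n.-tuple X -> R) (M : R) :
  measurable_fun setT g -> (forall t, 0 <= g t <= M) ->
  tint P (fun t => (g t)%:E) = (fine (tint P (fun t => (g t)%:E)))%:E /\
  0 <= fine (tint P (fun t => (g t)%:E)) <= M.
Proof.
move=> mg g0M.
have g0 t : (0 <= (g t)%:E)%E by rewrite lee_fin; have /andP[] := g0M t.
have I0 : (0 <= tint P (fun t => (g t)%:E))%E by exact: tint_ge0.
have IM : (tint P (fun t => (g t)%:E) <= M%:E)%E.
  rewrite -(tint_cst P n M); apply: le_tint => //; first exact/measurable_EFinP.
  by move=> t; rewrite lee_fin; have /andP[] := g0M t.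
have Ifin : tint P (fun t => (g t)%:E) \is a fin_num.
  by rewrite ge0_fin_numE// (le_lt_trans IM) ?ltry.
by rewrite -!lee_fin fineK// I0 IM.
Qed.

Lemma tint_affine n (P : nat -> probability X R) (g : n.-tuple X -> R) (M a b : R) :
  measurable_fun setT g -> (forall t, 0 <= g t <= M) -> 0 <= a -> 0 <= b ->
  tint P (fun t => (a + b * g t)%:E) = (a + b * fine (tint P (fun t => (g t)%:E)))%:E.
Proof.
move=> mg g0M a0 b0; have [gE _] := tint_bounded P mg g0M.
have g0 t : 0 <= g t by have /andP[] := g0M t.
have mgE : measurable_fun setT (fun t => (g t)%:E) by exact/measurable_EFinP.
have gE0 t : (0 <= (g t)%:E)%E by rewrite lee_fin.
rewrite EFinD EFinM -gE -(tintZl P b0 gE0 mgE) -[in RHS](tint_cst P n a) -tintD//.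
- by move=> t; rewrite lee_fin mulr_ge0.
- by apply: emeasurable_funM.
Qed.

Lemma replace_at_cons0 n (x y : X) (t : n.-tuple X) :
  replace_at (cons_tuple x t) ord0 y = cons_tuple y t.
Proof.
apply: eq_from_tnth => i; rewrite tnth_mktuple.
by case: (unliftP ord0 i) => [j ->|->]; rewrite ?tnthS ?tnth0.
Qed.

Lemma replace_at_consS n (x y : X) (t : n.-tuple X) k :
  replace_at (cons_tuple x t) (lift ord0 k) y = cons_tuple x (replace_at t k y).
Proof.
apply: eq_from_tnth => i; rewrite tnth_mktuple.
case: (unliftP ord0 i) => [j ->|->]; last by rewrite !tnth0.
by rewrite !tnthS tnth_mktuple (inj_eq lift_inj).
Qed.

Definition bounded_diff n (c : R) (Z : n.-tuple X -> R) :=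
  forall k x y y', Z (replace_at x k y) <= Z (replace_at x k y') + c.

Lemma bounded_diff_head n c (Z : n.+1.-tuple X -> R) : bounded_diff c Z ->
  forall x y t, Z (cons_tuple x t) <= Z (cons_tuple y t) + c.
Proof.
by move=> Zc x y t; have := Zc ord0 (cons_tuple x t) x y; rewrite !replace_at_cons0.
Qed.

Lemma bounded_diff_tail n c (Z : n.+1.-tuple X -> R) x : bounded_diff c Z ->
  bounded_diff c (fun t => Z (cons_tuple x t)).
Proof.
by move=> Zc k t y y'; have := Zc (lift ord0 k) (cons_tuple x t) y y'; rewrite !replace_at_consS.
Qed.

Lemma bounded_diff_bounded n c (Z : n.-tuple X -> R) : bounded_diff c Z ->
  forall x y, Z x <= Z y + n%:R * c.
Proof.
elim: n Z => [|n IH] Z Zc x y; first by rewrite (tuple0 x) (tuple0 y) mul0r addr0.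
case/tupleP: x => x t; case/tupleP: y => y u.
have h1 := IH _ (bounded_diff_tail x Zc) t u; have h2 := bounded_diff_head Zc x y u.
suff : Z (cons_tuple x t) <= Z (cons_tuple y u) + (n%:R + 1) * c by rewrite -natr1.
lra.
Qed.

Lemma measurable_cons_tail n (Z : n.+1.-tuple X -> R) x : measurable_fun setT Z ->
  measurable_fun setT (fun t : n.-tuple X => Z (cons_tuple x t)).
Proof. by move=> mZ; apply: (measurableT_comp mZ); exact: measurable_cons. Qed.

(* Minkowski's inequality in L^2, from (z + c)^2 <= (1 + c/q) z^2 + c q + c^2. *)
Lemma sqrt_tint_le n (c M : R) (Z1 Z2 : n.-tuple X -> R) : 0 <= c ->
  measurable_fun setT Z1 -> measurable_fun setT Z2 ->
  (forall t, 0 <= Z1 t <= M) -> (forall t, 0 <= Z2 t <= M) ->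
  (forall t, Z1 t <= Z2 t + c) ->
  Num.sqrt (fine (En (fun t => (Z1 t ^+ 2)%:E))) <=
  Num.sqrt (fine (En (fun t => (Z2 t ^+ 2)%:E))) + c.
Proof.
move=> c0 mZ1 mZ2 Z1M Z2M Z12.
have sqM Z : (forall t, 0 <= Z t <= M) -> forall t : n.-tuple X, 0 <= Z t ^+ 2 <= M ^+ 2.
  move=> ZM t; have /andP[Z0 ZMt] := ZM t; rewrite sqr_ge0/=.
  by rewrite ler_pXn2r ?nnegrE ?(le_trans Z0).
have mZ1s : measurable_fun setT (fun t => Z1 t ^+ 2) by exact: measurable_funX.
have mZ2s : measurable_fun setT (fun t => Z2 t ^+ 2) by exact: measurable_funX.
have [E1 /andP[W10 _]] := tint_bounded (fun=> mu) mZ1s (sqM _ Z1M).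
have [E2 /andP[W20 _]] := tint_bounded (fun=> mu) mZ2s (sqM _ Z2M).
set W1 := fine _ in E1 W10 *; set W2 := fine _ in E2 W20 *.
set r := Num.sqrt W2; have r0 : 0 <= r by exact: sqrtr_ge0.
have rW : r ^+ 2 = W2 by rewrite sqr_sqrtr.
(* The optimal weight is q = r, but r may vanish; q = r + e can be divided by, and e is
   arbitrary. *)
apply/ler_addgt0Pr => e e0; pose q := r + e.
have q0 : 0 < q by rewrite /q; lra.
have cq0 : 0 <= c / q by rewrite divr_ge0// ltW.
have : W1 <= (c * q + c ^+ 2) + (1 + c / q) * W2.
  rewrite -lee_fin -E1 -(tint_affine (fun=> mu) mZ2s (sqM _ Z2M)); last 2 first.
    by rewrite addr_ge0 ?mulr_ge0 ?sqr_ge0// ltW.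
    by rewrite addr_ge0.
  apply: le_tint.
  - by move=> t; rewrite lee_fin sqr_ge0.
  - exact/measurable_EFinP.
  - apply/measurable_EFinP; apply: measurable_funD => //; exact: measurable_funM.
  - move=> t; rewrite lee_fin; have /andP[Z10 _] := Z1M t; have /andP[Z20 _] := Z2M t.
    apply: (@le_trans _ _ ((Z2 t + c) ^+ 2)).
      by rewrite ler_pXn2r ?nnegrE ?addr_ge0.
    have := mulr_ge0 cq0 (sqr_ge0 (Z2 t - q)).
    have -> : c / q * (Z2 t - q) ^+ 2 = c / q * Z2 t ^+ 2 - 2 * c * Z2 t + c * q.
      by field; exact: lt0r_neq0.
    by rewrite sqrrD; lra.
rewrite mulrDl mul1r => hW; have : W1 <= (q + c) ^+ 2.
  have : c / q * W2 <= c * q.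
    rewrite -rW mulrAC ler_pdivrMr// -mulrA ler_wpM2l// -expr2.
    by rewrite ler_pXn2r ?nnegrE ?(ltW q0)// /q; lra.
  have : W2 <= q ^+ 2.
    by rewrite -rW ler_pXn2r ?nnegrE ?(ltW q0)// /q; lra.
  move=> h1 h2; have -> : (q + c) ^+ 2 = q ^+ 2 + 2 * (q * c) + c ^+ 2 by ring.
  lra.
have qc0 : 0 <= q + c by rewrite addr_ge0// ltW.
by move=> /ler_wsqrtr; rewrite sqrtr_sqr (ger0_norm qc0) /q; lra.
Qed.

(** The inner coordinates are integrated first. In the step to n + 1 the outer integral therefore
    meets D - 4 n, which the hypothesis taken at n + 1 keeps at 12 or more, as [expectation_expR_le]
    requires. *)
Lemma tint_expR_sqr_le n (c D M : R) (Z : n.-tuple X -> R) :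
  0 < c -> n%:R * 4 + 8 <= D -> measurable_fun setT Z ->
  (forall t, 0 <= Z t <= M) -> bounded_diff c Z ->
  (En (fun t => (expR (Z t ^+ 2 / (c ^+ 2 * D)))%:E) <=
   (expR (fine (En (fun t => (Z t ^+ 2)%:E)) / (c ^+ 2 * (D - n%:R * 4))))%:E)%E.
Proof.
move=> c0; elim: n D Z => [|n IH] D Z hD mZ ZM Zc.
  by rewrite /tint /= mul0r subr0.
have hD' : n%:R * 4 + 12 <= D by move: hD; rewrite -addn1 natrD; lra.
have mZx x := measurable_cons_tail x mZ.
have sqM t : 0 <= Z t ^+ 2 <= M ^+ 2.
  have /andP[Z0 ZMt] := ZM t; rewrite sqr_ge0/=.
  by rewrite ler_pXn2r ?nnegrE ?(le_trans Z0).
have mZs : measurable_fun setT (fun t => Z t ^+ 2) by exact: measurable_funX.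
pose W x := fine (En (fun t : n.-tuple X => (Z (cons_tuple x t) ^+ 2)%:E)).
have mI : measurable_fun setT
    (fun x => En (fun t : n.-tuple X => (Z (cons_tuple x t) ^+ 2)%:E)).
  apply: (@measurable_tint_cons _ _ _ (fun=> mu) n (fun t => (Z t ^+ 2)%:E)) => //.
    by move=> t; rewrite lee_fin sqr_ge0.
  exact/measurable_EFinP.
have mW : measurable_fun setT W by exact: measurableT_comp mI.
have WE x : En (fun t : n.-tuple X => (Z (cons_tuple x t) ^+ 2)%:E) = (W x)%:E /\
    0 <= W x <= M ^+ 2.
  by apply: tint_bounded => [|t]; [exact: (measurable_cons_tail x mZs)|exact: sqM].
have W0M x : 0 <= W x <= M ^+ 2 by have [] := WE x.
have WM x : `|W x| <= M ^+ 2 by have /andP[? ?] := W0M x; rewrite ger0_norm.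
have Wc x y : Num.sqrt (W x) <= Num.sqrt (W y) + c.
  apply: (sqrt_tint_le (M := M)) => //; [exact: ltW|].
  by move=> t; exact: bounded_diff_head.
have EW : fine (En (fun t => (Z t ^+ 2)%:E)) = Rintegral mu setT W.
  rewrite tintS /Rintegral; congr fine; apply: eq_integral => x _.
  by have [-> _] := WE x.
rewrite EW tintS.
have -> : D - n.+1%:R * 4 = (D - n%:R * 4) - 4 by rewrite -addn1 natrD; lra.
have D12 : 12 <= D - n%:R * 4 by lra.
apply: le_trans (expectation_expR_le mu c0 D12 mW W0M Wc).
apply: ge0_le_integral => //.
- by move=> x _; apply: tint_ge0 => t; rewrite lee_fin expR_ge0.
- apply: (@measurable_tint_cons _ _ _ (fun=> mu) n (fun t => (expR (Z t ^+ 2 / (c ^+ 2 * D)))%:E)).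
    by move=> t; rewrite lee_fin expR_ge0.
  apply/measurable_EFinP; apply: measurableT_comp => //; exact: measurable_funM.
- apply/measurable_EFinP; apply: measurableT_comp => //; exact: measurable_funM.
- move=> x _; apply: IH => //; [lra|exact: bounded_diff_tail].
Qed.

End tuple_concentration.

(** * Change of measure *)

Section euclidean.
Context {R : realType}.

Lemma sqrt_sum_sqr_triangle (I : finType) (p q : I -> R) :
  Num.sqrt (\sum_i (p i + q i) ^+ 2) <=
  Num.sqrt (\sum_i p i ^+ 2) + Num.sqrt (\sum_i q i ^+ 2).
Proof.
set P := \sum_i p i ^+ 2; set Q := \sum_i q i ^+ 2.
have P0 : 0 <= P by apply: sumr_ge0 => i _; exact: sqr_ge0.
have Q0 : 0 <= Q by apply: sumr_ge0 => i _; exact: sqr_ge0.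
apply/ler_addgt0Pr => e e0.
(* The weights exceed the two norms so that both can be divided by; the total excess is e. *)
pose a := Num.sqrt P + e / 2; pose b := Num.sqrt Q + e / 2.
have sP := sqrtr_ge0 P; have sQ := sqrtr_ge0 Q.
have a0 : 0 < a by rewrite /a; lra.
have b0 : 0 < b by rewrite /b; lra.
have Pa : P <= a ^+ 2.
  by rewrite -[leLHS](sqr_sqrtr P0) ler_pXn2r ?nnegrE ?(ltW a0)// /a; lra.
have Qb : Q <= b ^+ 2.
  by rewrite -[leLHS](sqr_sqrtr Q0) ler_pXn2r ?nnegrE ?(ltW b0)// /b; lra.
have an0 : a != 0 by exact: lt0r_neq0.
have bn0 : b != 0 by exact: lt0r_neq0.
have : \sum_i (p i + q i) ^+ 2 <= (1 + b / a) * P + (1 + a / b) * Q.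
  rewrite /P /Q !mulr_sumr -big_split /=; apply: ler_sum => i _.
  have : 0 <= a * b * (p i / a - q i / b) ^+ 2.
    by rewrite mulr_ge0 ?sqr_ge0// mulr_ge0 ?ltW.
  have -> : a * b * (p i / a - q i / b) ^+ 2 =
      (1 + b / a) * p i ^+ 2 + (1 + a / b) * q i ^+ 2 - (p i + q i) ^+ 2.
    by field; rewrite an0 bn0.
  by rewrite subr_ge0.
have : (1 + b / a) * P <= (1 + b / a) * a ^+ 2.
  by rewrite ler_wpM2l// addr_ge0// divr_ge0 ?ltW.
have : (1 + a / b) * Q <= (1 + a / b) * b ^+ 2.
  by rewrite ler_wpM2l// addr_ge0// divr_ge0 ?ltW.
have -> : (1 + a / b) * b ^+ 2 = b ^+ 2 + a * b by field.
have -> : (1 + b / a) * a ^+ 2 = a ^+ 2 + a * b by field.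
move=> h1 h2 h3.
have : \sum_i (p i + q i) ^+ 2 <= (a + b) ^+ 2.
  have -> : (a + b) ^+ 2 = a ^+ 2 + 2 * (a * b) + b ^+ 2 by ring.
  lra.
have ab0 : 0 <= a + b by rewrite addr_ge0 ?ltW.
by move=> /ler_wsqrtr; rewrite sqrtr_sqr (ger0_norm ab0) /a /b; lra.
Qed.

Lemma measurable_sqrt : measurable_fun [set: R] (@Num.sqrt R).
Proof. by apply: continuous_measurable_fun; exact: sqrt_continuous. Qed.

End euclidean.

(** * Gaussian posteriors over a fixed centre *)

Section gaussian_posterior.
Context {R : realType} {dX : measure_display} {X : measurableType dX}.
Variables (mu : probability X R) (n d : nat).
Variables (A : n.-tuple X -> d.-tuple R) (sigma : R).
Hypothesis A_meas : measurable_fun [set: n.-tuple X] A.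
Hypothesis n_gt0 : (0 < n)%N.
Hypothesis sigma_gt0 : 0 < sigma.

Local Notation TR := (measurableTypeR R).

Lemma EXnE (g : n.-tuple X -> \bar R) : EXn mu g = tint (fun=> mu) g.
Proof. by []. Qed.

Lemma EQE x (g : d.-tuple R -> \bar R) :
  EQ A sigma x g = tint (normals sigma (nth 0 (A x))) (g : d.-tuple TR -> \bar R).
Proof. by []. Qed.

Lemma measurable_nthA (i : 'I_d) : measurable_fun setT (fun x => nth 0 (A x) i).
Proof.
have -> : (fun x => nth 0 (A x) i) = (fun x => tnth (A x) i).
  by apply/funext => x; rewrite (tnth_nth 0).
exact: (measurableT_comp (measurable_tnth i) A_meas).
Qed.

Section base.
Variable a : d.-tuple R.

Definition lr x (h : d.-tuple R) : R := gauss_lr sigma (nth 0 (A x)) (nth 0 a) h.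

Lemma lr_ge0 x h : 0 <= lr x h.
Proof. exact: expR_ge0. Qed.

Lemma measurable_lr :
  measurable_fun setT (fun p : n.-tuple X * d.-tuple TR => lr p.1 p.2).
Proof.
apply: (measurable_gauss_lr sigma (nth 0 a)
  (u := fun p : n.-tuple X * d.-tuple TR => nth 0 (A p.1)) (v := snd)) => //.
by move=> i; exact: (measurableT_comp (measurable_nthA i)).
Qed.

Lemma EQ_shift (G : n.-tuple X -> d.-tuple R -> \bar R) x :
  (forall h, (0 <= G x h)%E) ->
  measurable_fun setT (fun p : n.-tuple X * d.-tuple TR => G p.1 p.2) ->
  EQ A sigma x (G x) =
  tint (normals sigma (nth 0 a)) (fun h : d.-tuple TR => (lr x h)%:E * G x h)%E.
Proof.
move=> G0 mG; rewrite EQE; apply: tint_normal_shift => //; first exact: lt0r_neq0.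
by apply: (measurable_uncurry (u := fun=> x) (v := id) mG).
Qed.

Lemma EQ_lr_sqr x :
  tint (normals sigma (nth 0 a)) (fun h : d.-tuple TR => (lr x h ^+ 2)%:E) =
  (expR ((\sum_(i < d) (tnth (A x) i - tnth a i) ^+ 2) / sigma ^+ 2))%:E.
Proof.
rewrite tint_gauss_lr_sqr; last exact: lt0r_neq0.
rewrite (eq_bigr (fun i : 'I_d => (tnth (A x) i - tnth a i) ^+ 2))// => i _.
by rewrite (tnth_nth 0 (A x)) (tnth_nth 0 a).
Qed.

End base.

Lemma measurable_lrM a (G : n.-tuple X -> d.-tuple R -> \bar R) :
  measurable_fun setT (fun p : n.-tuple X * d.-tuple TR => G p.1 p.2) ->
  measurable_fun setT (fun p : n.-tuple X * d.-tuple TR => ((lr a p.1 p.2)%:E * G p.1 p.2)%E).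
Proof.
move=> mG; apply: emeasurable_funM => //.
by apply/measurable_EFinP; exact: measurable_lr.
Qed.

(** The measure depends on [x] through its mean. Rewriting over the Gaussian centred at 0 moves this
    dependence into the integrand, where [measurable_tint] applies. *)
Lemma measurable_EQ (G : n.-tuple X -> d.-tuple R -> \bar R) :
  (forall x h, (0 <= G x h)%E) ->
  measurable_fun setT (fun p : n.-tuple X * d.-tuple TR => G p.1 p.2) ->
  measurable_fun setT (fun x => EQ A sigma x (G x)).
Proof.
move=> G0 mG; pose a : d.-tuple R := [tuple 0 | i < d].
have -> : (fun x => EQ A sigma x (G x)) = (fun x => tint (normals sigma (nth 0 a))
    (fun h : d.-tuple TR => (lr a x h)%:E * G x h)%E).
  by apply/funext => x; rewrite (EQ_shift a (G0 x) mG).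
apply: (measurable_tint _ (g := fun x (h : d.-tuple TR) => ((lr a x h)%:E * G x h)%E)).
  by move=> x h; rewrite mule_ge0 ?lee_fin ?lr_ge0.
exact: measurable_lrM.
Qed.

(** Markov's inequality by integrating 1 <= 1_E + G, which avoids subtracting integrals that may be
    infinite. *)
Lemma EXnEQ_markov (E : n.-tuple X -> d.-tuple R -> Prop)
    (G : n.-tuple X -> d.-tuple R -> \bar R) (delta : R) :
  measurable [set p : n.-tuple X * d.-tuple TR | E p.1 p.2] ->
  (forall x h, (0 <= G x h)%E) ->
  measurable_fun setT (fun p : n.-tuple X * d.-tuple TR => G p.1 p.2) ->
  (forall x h, ~ E x h -> (1 <= G x h)%E) ->
  (EXn mu (fun x => EQ A sigma x (G x)) <= delta%:E)%E ->
  ((1 - delta)%:E <= ProbXQ mu A sigma E)%E.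
Proof.
move=> mE G0 mG EG Gd.
pose I x (h : d.-tuple R) : \bar R := (\1_[set h | E x h] h)%:E.
have I0 x h : (0 <= I x h)%E by rewrite lee_fin.
have mI : measurable_fun setT (fun p : n.-tuple X * d.-tuple TR => I p.1 p.2).
  have -> : (fun p : n.-tuple X * d.-tuple TR => I p.1 p.2) =
      EFin \o \1_[set p : n.-tuple X * d.-tuple TR | E p.1 p.2].
    apply/funext => -[x h]; rewrite /I /= !indicE.
    by have [Eh|nEh] := pselect (E x h); [rewrite !mem_set|rewrite !memNset].
  by apply/measurable_EFinP; exact: measurable_indic.
rewrite EFinB leeBlDr//; apply: (le_trans _ (leeD2l _ Gd)).
rewrite /ProbXQ !EXnE -tintD; last 4 first.
- by move=> x; rewrite EQE; apply: tint_ge0 => h; exact: (I0 x).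
- exact: (measurable_EQ I0 mI).
- by move=> x; rewrite EQE; apply: tint_ge0 => h; exact: G0.
- exact: measurable_EQ.
rewrite -(tint_cst (fun=> mu) n 1); apply: le_tint => //.
  by apply: emeasurable_funD; [exact: (measurable_EQ I0 mI)|exact: measurable_EQ].
move=> x; have mIx : measurable_fun setT (fun h : d.-tuple TR => I x h).
  exact: (measurable_uncurry (u := fun=> x) (v := id) mI).
have mGx : measurable_fun setT (fun h : d.-tuple TR => G x h).
  exact: (measurable_uncurry (u := fun=> x) (v := id) mG).
rewrite !EQE -(tintD (normals sigma (nth 0 (A x))) (I0 x) mIx (G0 x) mGx).
rewrite -(tint_cst (normals sigma (nth 0 (A x))) d 1); apply: le_tint => //.
  by apply: emeasurable_funD.
move=> h; rewrite /I indicE.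
have [Eh|nEh] := pselect (E x h).
  by rewrite mem_set//= leeDl.
by rewrite memNset//= add0e EG.
Qed.

Section bounded_sensitivity.
Hypothesis hsigma :
  (((12 * n)%:R)%:E * (hyp_sens A * hyp_sens A) <= (sigma ^+ 2)%:E)%E.
Variable a : d.-tuple R.

Let Z (x : n.-tuple X) : R := Num.sqrt (\sum_(i < d) (tnth (A x) i - tnth a i) ^+ 2).

Let Zsq x : Z x ^+ 2 = \sum_(i < d) (tnth (A x) i - tnth a i) ^+ 2.
Proof. by rewrite sqr_sqrtr// sumr_ge0// => i _; exact: sqr_ge0. Qed.

Let ZsqE : (fun x => (Z x ^+ 2)%:E) =
  (fun x => (\sum_(i < d) (tnth (A x) i - tnth a i) ^+ 2)%:E).
Proof. by apply/funext => x; rewrite Zsq. Qed.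

(** The largest sensitivity that [hsigma] permits, rather than c_A itself: it is positive even when
    [A] is constant, and c^2 * 12 n is exactly sigma^2. *)
Let c : R := sigma / Num.sqrt (12 * n)%:R.

Let n12_gt0 : 0 < (12 * n)%:R :> R.
Proof. by rewrite ltr0n muln_gt0. Qed.

Let c_gt0 : 0 < c.
Proof. by rewrite divr_gt0// sqrtr_gt0. Qed.

Let c_sqr : c ^+ 2 = sigma ^+ 2 / (12 * n)%:R.
Proof. by rewrite expr_div_n sqr_sqrtr// ltW. Qed.

Let Z_bounded_diff : bounded_diff c Z.
Proof.
move=> k x y y'; pose u := A (replace_at x k y); pose v := A (replace_at x k y').
pose r := Num.sqrt (dist2 u v).
have rH : (r%:E <= hyp_sens A)%E.
  by apply: ereal_sup_ubound; exists k, x, y, y'.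
have r0 : 0 <= r by exact: sqrtr_ge0.
have rc : r <= c.
  rewrite -(@ler_pXn2r _ 2) ?nnegrE ?(ltW c_gt0)// c_sqr ler_pdivlMr// mulrC.
  rewrite -lee_fin EFinM; apply: (le_trans _ hsigma).
  by rewrite lee_pmul ?lee_fin// ?sqr_ge0 ?ler0n// expr2 EFinM lee_pmul// lee_fin.
apply: le_trans (_ : Z (replace_at x k y') + r <= _); last by rewrite lerD2l.
rewrite /Z -/u -/v /r /dist2 (eq_bigr (fun i : 'I_d =>
  ((tnth v i - tnth a i) + (tnth u i - tnth v i)) ^+ 2)).
  exact: sqrt_sum_sqr_triangle.
by move=> i _; congr (_ ^+ 2); ring.
Qed.

Let Z_ge0 x : 0 <= Z x.
Proof. exact: sqrtr_ge0. Qed.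

(** Bounded differences keep [Z] within n c of any one of its values; this is the source of the
    finiteness of [V]. *)
Let Z_bounded : exists M, forall x, 0 <= Z x <= M.
Proof.
have [[y _]|nX] := pselect (exists y : n.-tuple X, True).
  exists (Z y + n%:R * c) => x; rewrite Z_ge0/=.
  exact: bounded_diff_bounded Z_bounded_diff x y.
by exists 0 => x; case: nX; exists x.
Qed.

Let Z_meas : measurable_fun setT Z.
Proof.
apply: (measurableT_comp (@measurable_sqrt R)); apply: measurable_sum => i.
apply: measurable_funX; apply: measurable_funB => //.
exact: (measurableT_comp (measurable_tnth i) A_meas).
Qed.

Let V : R := fine (EXn mu (fun x =>
  (\sum_(i < d) (tnth (A x) i - tnth a i) ^+ 2)%:E)).

Lemma variance_fin_num :
  EXn mu (fun x => (\sum_(i < d) (tnth (A x) i - tnth a i) ^+ 2)%:E) = V%:E /\ 0 <= V.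
Proof.
have [M ZM] := Z_bounded.
have mZs : measurable_fun setT (fun x => Z x ^+ 2) by exact: measurable_funX.
have ZsM x : 0 <= Z x ^+ 2 <= M ^+ 2.
  have /andP[Z0 ZMt] := ZM x; rewrite sqr_ge0/=.
  by rewrite ler_pXn2r ?nnegrE ?(le_trans Z0).
have [] := tint_bounded (fun=> mu) mZs ZsM.
by rewrite /V EXnE ZsqE => -> /andP[].
Qed.

(** The coordinates take D from 12 n to 8 n, so the exponent obtained is (3/2) V / sigma^2. It is
    relaxed to 6, whose half is the 3 of the final bounds. *)
Lemma EXn_expR_dist2_le :
  (EXn mu (fun x =>
     (expR ((\sum_(i < d) (tnth (A x) i - tnth a i) ^+ 2) / sigma ^+ 2))%:E)
   <= (expR (6 * V / sigma ^+ 2))%:E)%E.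
Proof.
have [M ZM] := Z_bounded; have [VE V0] := variance_fin_num.
have n1 : 1 <= n%:R :> R by rewrite ler1n.
have nn0 : n%:R != 0 :> R by rewrite pnatr_eq0 -lt0n.
have sn0 : sigma != 0 by exact: lt0r_neq0.
have hD : n%:R * 4 + 8 <= (12 * n)%:R :> R by rewrite natrM; lra.
have := tint_expR_sqr_le mu c_gt0 hD Z_meas ZM Z_bounded_diff.
have -> : (fun x => (expR (Z x ^+ 2 / (c ^+ 2 * (12 * n)%:R)))%:E) = (fun x =>
    (expR ((\sum_(i < d) (tnth (A x) i - tnth a i) ^+ 2) / sigma ^+ 2))%:E).
  by apply/funext => x; rewrite Zsq c_sqr divfK// lt0r_neq0.
rewrite ZsqE; move=> /le_trans; apply; rewrite -EXnE -/V lee_fin ler_expR c_sqr natrM.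
have -> : V / (sigma ^+ 2 / (12 * n%:R) * (12 * n%:R - n%:R * 4)) =
    (3 / 2) * V / sigma ^+ 2.
  by field; rewrite nn0 sn0 /= gt_eqF//; lra.
rewrite ler_wpM2r ?invr_ge0 ?sqr_ge0//; lra.
Qed.

(** Cauchy-Schwarz between the likelihood ratio and [G], with each half of the pointwise split
    contributing K N / 2. *)
Lemma EXnEQ_le (G : n.-tuple X -> d.-tuple R -> \bar R) (K : R) : 0 < K ->
  (forall x h, (0 <= G x h)%E) ->
  measurable_fun setT (fun p : n.-tuple X * d.-tuple TR => G p.1 p.2) ->
  (forall h, (EXn mu (fun x => G x h * G x h) <= (K ^+ 2)%:E)%E) ->
  (EXn mu (fun x => EQ A sigma x (G x)) <= (K * expR (3 * V / sigma ^+ 2))%:E)%E.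
Proof.
move=> K0 G0 mG GK; set N := expR _.
have N0 : 0 < N by exact: expR_gt0.
have NN : N ^+ 2 = expR (6 * V / sigma ^+ 2).
  by rewrite -expRM_natl; congr expR; lra.
(* The ratio of the two L^2 bounds, which balances t N^2 / 2 and K^2 / (2 t). *)
pose t := K / N; have t0 : 0 < t by rewrite divr_gt0.
pose Q := normals sigma (nth 0 a).
pose S x (h : d.-tuple TR) : \bar R := ((t / 2) * lr a x h ^+ 2)%:E.
pose B x (h : d.-tuple TR) : \bar R := ((2 * t)^-1%:E * (G x h * G x h))%E.
have S0 x h : (0 <= S x h)%E.
  by rewrite lee_fin mulr_ge0 ?sqr_ge0// divr_ge0// ltW.
have t20 : 0 <= (2 * t)^-1 by rewrite invr_ge0 mulr_ge0// ltW.
have B0 x h : (0 <= B x h)%E by rewrite mule_ge0 ?lee_fin// mule_ge0.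
have mS : measurable_fun setT (fun p : n.-tuple X * d.-tuple TR => S p.1 p.2).
  apply/measurable_EFinP; apply: measurable_funM => //; apply: measurable_funX.
  exact: measurable_lr.
have mGG : measurable_fun setT
    (fun p : n.-tuple X * d.-tuple TR => (G p.1 p.2 * G p.1 p.2)%E).
  exact: emeasurable_funM.
have mB : measurable_fun setT (fun p : n.-tuple X * d.-tuple TR => B p.1 p.2).
  by apply: emeasurable_funM.
have section F : measurable_fun setT (fun p : n.-tuple X * d.-tuple TR => F p.1 p.2 : \bar R) ->
    forall x, measurable_fun setT (F x).
  by move=> mF x; exact: (measurable_uncurry (u := fun=> x) (v := id) mF).
have SB x h : ((lr a x h)%:E * G x h <= S x h + B x h)%E.
  rewrite /S /B; move: (G0 x h); case: (G x h) => [g| |]//.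
    move=> _; rewrite -!EFinM -EFinD lee_fin.
    have := mulr_ge0 (ltW t0) (sqr_ge0 (lr a x h - g / t)).
    have -> : t * (lr a x h - g / t) ^+ 2 =
        2 * (t / 2 * lr a x h ^+ 2 + (2 * t)^-1 * (g * g) - lr a x h * g).
      by field; exact: lt0r_neq0.
    by rewrite pmulr_rge0// subr_ge0.
  move=> _; rewrite [X in (_ + X)%E](_ : _ = +oo%E) ?addey ?leey//.
  by rewrite mulyy gt0_muley// lte_fin invr_gt0 mulr_gt0.
apply: (@le_trans _ _ (EXn mu (fun x => tint Q (S x) + tint Q (B x)))%E).
  rewrite !EXnE; apply: le_tint.
  - by move=> x; rewrite EQE; apply: tint_ge0 => h; exact: G0.
  - exact: measurable_EQ.
  - by apply: emeasurable_funD; exact: measurable_tint.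
  - move=> x; rewrite (EQ_shift a (G0 x) mG) -tintD//; [|exact: section..].
    apply: le_tint.
    + by move=> h; rewrite mule_ge0 ?lee_fin ?lr_ge0.
    + exact: (section (fun x h => (lr a x h)%:E * G x h)%E (measurable_lrM a mG)).
    + by apply: emeasurable_funD; exact: section.
    + exact: SB.
rewrite EXnE tintD; last 4 first.
- by move=> x; exact: tint_ge0.
- exact: measurable_tint.
- by move=> x; exact: tint_ge0.
- exact: measurable_tint.
have -> : K * N = K * N / 2 + K * N / 2 by field.
rewrite EFinD; apply: leeD.
  have -> : tint (fun=> mu) (fun x => tint Q (S x)) = ((t / 2)%:E * EXn mu (fun x =>
     (expR ((\sum_(i < d) (tnth (A x) i - tnth a i) ^+ 2) / sigma ^+ 2))%:E))%E.
    have t2 : 0 <= t / 2 by rewrite divr_ge0// ltW.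
    have l0 x (h : d.-tuple TR) : (0 <= (lr a x h ^+ 2)%:E)%E.
      by rewrite lee_fin sqr_ge0.
    have ml x : measurable_fun setT (fun h : d.-tuple TR => (lr a x h ^+ 2)%:E).
      apply/measurable_EFinP; apply: measurable_funX.
      exact: (measurable_uncurry (u := fun=> x) (v := id) (measurable_lr a)).
    rewrite EXnE -(tintZl _ t2).
    - by apply: eq_tint => x; rewrite -(EQ_lr_sqr a) -(tintZl _ t2 (l0 x) (ml x)).
    - by move=> x; rewrite lee_fin expR_ge0.
    - apply/measurable_EFinP; apply: measurableT_comp => //.
      apply: measurable_funM => //; apply: measurable_sum => i.
      apply: measurable_funX; apply: measurable_funB => //.
      exact: (measurableT_comp (measurable_tnth i) A_meas).
  apply: (@le_trans _ _ ((t / 2)%:E * (N ^+ 2)%:E)%E).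
    by rewrite NN lee_wpmul2l ?EXn_expR_dist2_le// lee_fin divr_ge0// ltW.
  rewrite -EFinM lee_fin /t le_eqVlt; apply/orP; left; apply/eqP.
  by field; exact: lt0r_neq0.
(* The reference law [Q] does not depend on [x], so [h] can be frozen and the moment hypothesis [GK]
   used. *)
rewrite tint_swap//.
apply: (@le_trans _ _ (tint Q (fun h : d.-tuple TR => ((2 * t)^-1 * K ^+ 2)%:E))).
  apply: le_tint.
  - by move=> h; apply: tint_ge0 => x.
  - apply: (@measurable_tint _ _ _ _ _ _ _ (fun (h : d.-tuple TR) x => B x h)) => //.
    exact: (measurable_uncurry (u := snd) (v := fst) mB).
  - exact: measurable_cst.
  - move=> h; rewrite tintZl//.
    + by rewrite EFinM lee_wpmul2l ?lee_fin//; exact: GK.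
    + by move=> x; rewrite mule_ge0.
    + exact: (measurable_uncurry (u := id) (v := fun=> h)
        (g := fun x h => G x h * G x h)%E mGG).
rewrite tint_cst lee_fin /t le_eqVlt; apply/orP; left; apply/eqP.
by field; rewrite !lt0r_neq0.
Qed.

End bounded_sensitivity.
End gaussian_posterior.

(** * Bernoulli relative entropy *)

Section bernoulli_relative_entropy.
Context {R : realType}.
Implicit Types (s t p a b : R).

(** Real-valued form of [kl], which it equals for 0 < t < 1; at s = 0 and s = 1 the vanishing factor
    realizes the convention 0 ln 0 = 0. *)
Definition klr s t : R := s * ln (s / t) + (1 - s) * ln ((1 - s) / (1 - t)).

Lemma xlrE s t : 0 < t -> xlr s t = (s * ln (s / t))%:E.
Proof.
by move=> t0; rewrite /xlr (gt_eqF t0); have [->|_] := eqVneq s 0; rewrite ?mul0r.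
Qed.

Lemma klE s t : 0 < t < 1 -> kl s t = (klr s t)%:E.
Proof.
by move=> /andP[t0 t1]; rewrite /kl /klr EFinD !xlrE ?subr_gt0.
Qed.

(** The tangent at [t] of the convex function s ln (s / p), obtained from ln (t / s) <= t / s - 1.
    The terms s - t cancel when both outcomes are added. *)
Lemma xlr_tangent s t p : 0 <= s -> 0 < t -> 0 < p ->
  s * ln (t / p) + (s - t) <= s * ln (s / p).
Proof.
rewrite le_eqVlt => /predU1P[<- t0 _|s0 t0 p0]; first by rewrite !mul0r; lra.
rewrite !ln_div ?posrE//.
have ts0 : 0 < t / s by rewrite divr_gt0.
have := @le_ln1Dx _ (t / s - 1) ltac:(lra); rewrite subrKC ln_div ?posrE// => h.
have := ler_wpM2l (ltW s0) h.
rewrite (_ : s * (t / s - 1) = t - s); last by field; exact: lt0r_neq0.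
lra.
Qed.

Lemma klr_tangent s t p : 0 <= s <= 1 -> 0 < t < 1 -> 0 < p < 1 ->
  s * ln (t / p) + (1 - s) * ln ((1 - t) / (1 - p)) <= klr s p.
Proof.
move=> /andP[s0 s1] /andP[t0 t1] /andP[p0 p1].
have := xlr_tangent s0 t0 p0.
have := @xlr_tangent (1 - s) (1 - t) (1 - p) ltac:(lra) ltac:(lra) ltac:(lra).
by rewrite /klr; lra.
Qed.

Lemma xlr_not_Ny a b : xlr a b != -oo%E.
Proof. by rewrite /xlr; case: ifP => // _; case: ifP. Qed.

Lemma kl_ge0 s t : 0 <= s <= 1 -> 0 <= t <= 1 -> (0 <= kl s t)%E.
Proof.
move=> /andP[s0 s1] /andP[t0 t1].
have [t0'|tn0] := eqVneq t 0.
  rewrite /kl t0' subr0 {1}/xlr eqxx; case: eqVneq => [->|sn0].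
    by rewrite add0e subr0 xlrE// divr1 ln1 mulr0.
  by rewrite addye ?leey// xlr_not_Ny.
have [t1'|tn1] := eqVneq t 1.
  rewrite /kl t1' subrr {2}/xlr eqxx; case: eqVneq => [s1'|sn1].
    have -> : s = 1 by lra.
    by rewrite xlrE// divr1 ln1 mulr0 adde0.
  by rewrite addey ?leey// xlr_not_Ny.
have t01 : 0 < t < 1 by rewrite !lt_neqAle eq_sym tn0 tn1 t0 t1.
rewrite klE// lee_fin.
have /andP[h1 h2] := t01.
have := @klr_tangent s t t _ t01 t01; rewrite s0 s1 => /(_ isT); apply: le_trans.
by rewrite !divff ?ln1 ?mulr0 ?addr0//; apply: lt0r_neq0; lra.
Qed.

(** Convexity without second derivatives: the tangent of [klr] at the intermediate point gives an
    exponent affine in x, to which [expR_le_chord] applies; at both ends the tangent lies below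
    [klr]. *)
Lemma expR_klr_chord (N p a x : R) : 0 < p < 1 -> 0 < N -> 0 <= a -> a + 1 <= N ->
  0 <= x <= 1 ->
  expR (N * klr ((a + x) / N) p) <=
  (1 - x) * expR (N * klr (a / N) p) + x * expR (N * klr ((a + 1) / N) p).
Proof.
move=> p01 N0 a0 aN /andP[x0 x1].
have Nn0 : N != 0 by exact: lt0r_neq0.
(* The end points are set apart because only there can (a + x) / N be 0 or 1, where no tangent
   exists. *)
have [->|xn0] := eqVneq x 0; first by rewrite addr0 subr0 mul1r mul0r addr0.
have [->|xn1] := eqVneq x 1; first by rewrite subrr mul0r add0r mul1r.
have {}x0 : 0 < x by rewrite lt_neqAle eq_sym xn0.
have {}x1 : x < 1 by rewrite lt_neqAle xn1.
set t := (a + x) / N.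
have t01 : 0 < t < 1.
  by rewrite divr_gt0 ?ltr_pdivrMr//; lra.
set al := ln (t / p); set be := ln ((1 - t) / (1 - p)).
have tang y : 0 <= y <= N -> y * al + (N - y) * be <= N * klr (y / N) p.
  move=> /andP[y0 yN].
  have yN1 : 0 <= y / N <= 1 by rewrite divr_ge0 ?(ltW N0)//= ler_pdivrMr// mul1r.
  have := ler_wpM2l (ltW N0) (klr_tangent yN1 t01 p01).
  rewrite -/al -/be.
  by have -> : N * (y / N * al + (1 - y / N) * be) = y * al + (N - y) * be by field.
have -> : N * klr t p = (a * al + (N - a) * be) + (al - be) * x.
  by rewrite /klr -/al -/be /t; field.
rewrite expRD.
apply: (@le_trans _ _ (expR (a * al + (N - a) * be) * (1 + (expR (al - be) - 1) * x))).
  by rewrite ler_wpM2l ?expR_ge0// expR_le_chord// !ltW.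
have h1 := tang a ltac:(lra); have h2 := tang (a + 1) ltac:(lra).
rewrite -ler_expR in h1; rewrite -ler_expR in h2.
have -> : expR (a * al + (N - a) * be) * (1 + (expR (al - be) - 1) * x) =
   (1 - x) * expR (a * al + (N - a) * be) +
   x * (expR (a * al + (N - a) * be) * expR (al - be)) by ring.
rewrite -expRD lerD// ler_wpM2l ?subr_ge0 ?(ltW x0) ?(ltW x1)//.
apply: le_trans h2; rewrite ler_expR; lra.
Qed.

(** The expectation of phi (s + B) for B binomial (m, p), unrolled trial by trial to match the
    recursion of [iter_int]. *)
Fixpoint bernoulli_mean p (phi : R -> R) (m : nat) s : R :=
  if m is k.+1 then
    (1 - p) * bernoulli_mean p phi k s + p * bernoulli_mean p phi k (s + 1)
  else phi s.

Lemma bernoulli_meanE p phi m s : bernoulli_mean p phi m s =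
  \sum_(k < m.+1) 'C(m, k)%:R * p ^+ k * (1 - p) ^+ (m - k) * phi (s + k%:R).
Proof.
elim: m s => [|m IH] s /=.
  by rewrite big_ord1 /= bin0 !expr0 !mul1r addr0.
rewrite !IH !mulr_sumr [in RHS]big_ord_recl /= bin0 expr0 subn0 addr0.
under [in RHS]eq_bigr => k _ do rewrite /bump /= add1n binS natrD !mulrDl.
rewrite big_split /= addrA; congr (_ + _).
  rewrite [in LHS]big_ord_recl /= bin0 expr0 subn0 addr0; congr (_ + _).
    by rewrite exprS; ring.
  rewrite [in RHS]big_ord_recr /= bin_small// !mul0r addr0.
  apply: eq_bigr => k _; rewrite /bump /= add1n subSS.
  by rewrite (_ : (m - k)%N = (m - k.+1).+1) ?exprS; [ring|rewrite subnSK].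
apply: eq_bigr => k _; have -> : s + k.+1%:R = s + 1 + k%:R by rewrite -natr1; ring.
by rewrite subSS exprS; ring.
Qed.

(** The exponential of n [klr] (k/n, p) is the likelihood ratio of k successes under k/n against p,
    so p cancels from each term. *)
Lemma bernoulli_mean_expR_klr p n : 0 < p < 1 -> (0 < n)%N ->
  bernoulli_mean p (fun s => expR (n%:R * klr (s / n%:R) p)) n 0 =
  \sum_(k < n.+1) 'C(n, k)%:R * (k%:R / n%:R) ^+ k * (1 - k%:R / n%:R) ^+ (n - k).
Proof.
move=> /andP[p0 p1] n0; have n0R : (0 : R) < n%:R by rewrite ltr0n.
have nn0 : (n%:R : R) != 0 by exact: lt0r_neq0.
(* The alternative k = 0 covers y = 0, where [ln] cannot be inverted. *)
have powE (k : nat) (y q : R) : 0 < q -> (0 < k)%N && (0 < y) || (k == 0%N) ->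
    q ^+ k * expR (k%:R * ln (y / q)) = y ^+ k.
  move=> q0 /orP[/andP[_ y0]|/eqP ->]; last by rewrite mul0r expR0 mulr1.
  by rewrite expRM_natl lnK ?posrE ?divr_gt0// -exprMn mulrCA divff ?mulr1// lt0r_neq0.
rewrite bernoulli_meanE; apply: eq_bigr => k _; rewrite add0r.
have kn : (k <= n)%N by rewrite -ltnS.
have -> : n%:R * klr (k%:R / n%:R) p = k%:R * ln (k%:R / n%:R / p) +
    (n - k)%:R * ln ((1 - k%:R / n%:R) / (1 - p)).
  by rewrite /klr natrB//; field.
rewrite expRD.
have h1 : p ^+ k * expR (k%:R * ln (k%:R / n%:R / p)) = (k%:R / n%:R) ^+ k.
  apply: powE => //; case: (posnP k) => [->|k0]; first by rewrite orbT.
  by rewrite divr_gt0 ?ltr0n.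
have h2 : (1 - p) ^+ (n - k) * expR ((n - k)%:R * ln ((1 - k%:R / n%:R) / (1 - p)))
    = (1 - k%:R / n%:R) ^+ (n - k).
  apply: powE; first by rewrite subr_gt0.
  case: (posnP (n - k)%N) => [_|k0]; first by rewrite orbT.
  by rewrite subr_gt0 ltr_pdivrMr// mul1r ltr_nat -subn_gt0 k0.
by rewrite -h1 -h2; ring.
Qed.

Lemma measurable_expeR : measurable_fun [set: \bar R] (@expeR R).
Proof.
have -> : @expeR R = (fun x => if x == +oo%E then +oo%E else
    if x == -oo%E then 0%E else (expR (fine x))%:E).
  by apply/funext => -[r| |].
apply: measurable_fun_ifT => //; first exact: measurable_fun_eqe.
apply: measurable_fun_ifT => //; first exact: measurable_fun_eqe.
by apply/measurable_EFinP; apply: measurableT_comp.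
Qed.

(** Splitting the logarithm of the quotient into a difference avoids the measurability of a
    division. *)
Lemma measurable_xlr {dV} {V : measurableType dV} (u v : V -> R) :
  (forall z, 0 <= u z) -> (forall z, 0 <= v z) ->
  measurable_fun setT u -> measurable_fun setT v ->
  measurable_fun setT (fun z => xlr (u z) (v z)).
Proof.
move=> u0 v0 mu mv.
have -> : (fun z => xlr (u z) (v z)) = (fun z => if u z == 0 then 0%E else
    if v z == 0 then +oo%E else (u z * (ln (u z) - ln (v z)))%:E).
  apply/funext => z; rewrite /xlr; case: eqVneq => // uz; case: eqVneq => // vz.
  by rewrite ln_div// posrE lt_neqAle eq_sym ?uz ?vz ?u0 ?v0.
apply: measurable_fun_ifT => //; first exact: measurable_fun_eqr.
apply: measurable_fun_ifT => //; first exact: measurable_fun_eqr.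
apply/measurable_EFinP; apply: measurable_funM => //.
by apply: measurable_funB; exact: (measurableT_comp (@measurable_ln R)).
Qed.

Lemma measurable_kl {dV} {V : measurableType dV} (u v : V -> R) :
  (forall z, 0 <= u z <= 1) -> (forall z, 0 <= v z <= 1) ->
  measurable_fun setT u -> measurable_fun setT v ->
  measurable_fun setT (fun z => kl (u z) (v z)).
Proof.
move=> u01 v01 mu mv; apply: emeasurable_funD; apply: measurable_xlr => //.
- by move=> z; have /andP[] := u01 z.
- by move=> z; have /andP[] := v01 z.
- by move=> z; rewrite subr_ge0; have /andP[] := u01 z.
- by move=> z; rewrite subr_ge0; have /andP[] := v01 z.
- exact: measurable_funB.
- exact: measurable_funB.
Qed.

End bernoulli_relative_entropy.

(** * Moments of i.i.d. sums *)

Section iid_moments.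
Context {R : realType} {d} {X : measurableType d} (mu : probability X R).

Local Notation Ex Y := (Rintegral mu setT Y).

Lemma measurable_sum_tnth n (psi : X -> R) : measurable_fun setT psi ->
  measurable_fun setT (fun t : n.-tuple X => \sum_(i < n) psi (tnth t i)).
Proof.
move=> mpsi; apply: measurable_sum => i.
exact: (measurableT_comp mpsi (measurable_tnth i)).
Qed.

Lemma sum_cons_tuple n (psi : X -> R) x (t : n.-tuple X) :
  \sum_(i < n.+1) psi (tnth (cons_tuple x t) i) = psi x + \sum_(i < n) psi (tnth t i).
Proof.
by rewrite big_ord_recl tnth0; congr (_ + _); apply: eq_bigr => i _; rewrite tnthS.
Qed.

Lemma tint_expR_sum_le n (psi : X -> R) (K : R) : 0 <= K ->
  measurable_fun setT psi -> (\int[mu]_x (expR (psi x))%:E <= K%:E)%E ->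
  (tint (fun=> mu) (fun t : n.-tuple X => (expR (\sum_(i < n) psi (tnth t i)))%:E)
   <= (K ^+ n)%:E)%E.
Proof.
move=> K0 mpsi psiK.
have mE : measurable_fun setT (fun x => (expR (psi x))%:E).
  by apply/measurable_EFinP; exact: measurableT_comp.
elim: n => [|n IH]; first by rewrite /tint /= big_ord0 expR0 expr0.
pose S (t : n.-tuple X) := (expR (\sum_(i < n) psi (tnth t i)))%:E.
have S0 t : (0 <= S t)%E by rewrite lee_fin expR_ge0.
have mS : measurable_fun setT S.
  apply/measurable_EFinP; apply: measurableT_comp => //.
  exact: measurable_sum_tnth.
have -> : tint (fun=> mu) (fun t : n.+1.-tuple X =>
    (expR (\sum_(i < n.+1) psi (tnth t i)))%:E) =
    (\int[mu]_x ((expR (psi x))%:E * tint (fun=> mu) S))%E.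
  rewrite tintS; apply: eq_integral => x _.
  rewrite -tintZl ?expR_ge0//; apply: eq_tint => t.
  by rewrite sum_cons_tuple expRD EFinM.
rewrite ge0_integralZr//; last exact: tint_ge0.
rewrite exprS EFinM; apply: lee_pmul => //; last exact: tint_ge0.
by apply: integral_ge0 => x _; rewrite lee_fin expR_ge0.
Qed.

Variable Y : X -> R.
Hypothesis mY : measurable_fun setT Y.
Hypothesis Y01 : forall x, 0 <= Y x <= 1.

Let p := Ex Y.

Let Y_norm x : `|Y x| <= 1.
Proof. by have /andP[? ?] := Y01 x; rewrite ger0_norm. Qed.

Lemma Ex01 : 0 <= p <= 1.
Proof.
by apply/andP; split; [apply: (Ex_ge_bound mu mY Y_norm)|apply: (Ex_le_bound mu mY Y_norm)] => x;
  have /andP[] := Y01 x.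
Qed.

Lemma hoeffding_centered (s : R) :
  (\int[mu]_x (expR (s * (p - Y x)))%:E <= (expR (s ^+ 2 / 8))%:E)%E.
Proof.
have -> : (\int[mu]_x (expR (s * (p - Y x)))%:E)%E =
    ((expR (s * p))%:E * \int[mu]_x (expR (- s * Y x))%:E)%E.
  rewrite -ge0_integralZl_EFin ?expR_ge0//.
  - by apply: eq_integral => x _; rewrite -EFinM -expRD; congr (expR _)%:E; ring.
  - by apply/measurable_EFinP; apply: measurableT_comp => //; exact: measurable_funM.
apply: (@le_trans _ _ ((expR (s * p))%:E * (expR (- s * p + (- s) ^+ 2 / 8))%:E)%E).
  rewrite lee_wpmul2l ?lee_fin ?expR_ge0//; exact: hoeffding01.
rewrite -EFinM -expRD lee_fin ler_expR; lra.
Qed.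

Lemma variance_ge0 : 0 <= Ex (fun x => (Y x - p) ^+ 2).
Proof. by apply: Rintegral_ge0 => x _; exact: sqr_ge0. Qed.

(** The linear term has mean zero, and 1 + z <= e^z absorbs the rest. *)
Lemma expR_quad_integral (s C : R) :
  (forall x, expR (s * (p - Y x)) <= 1 + s * (p - Y x) + C * (s * (p - Y x)) ^+ 2) ->
  (\int[mu]_x (expR (s * (p - Y x)))%:E <=
   (expR (C * s ^+ 2 * Ex (fun x => (Y x - p) ^+ 2)))%:E)%E.
Proof.
move=> hC; set v := Ex _.
have mU : measurable_fun setT (fun x => (Y x - p) ^+ 2).
  by apply: measurable_funX; exact: measurable_funB.
have [p0 p1] := andP Ex01.
have U1 x : `|(Y x - p) ^+ 2| <= 1.
  have /andP[? ?] := Y01 x; rewrite ger0_norm ?sqr_ge0//.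
  have : 0 <= (1 - (Y x - p)) * (1 + (Y x - p)) by rewrite mulr_ge0//; lra.
  lra.
pose f1 x := (1 + s * p) + (- s) * Y x; pose f2 x := 0 + (C * s ^+ 2) * (Y x - p) ^+ 2.
have mf1 : measurable_fun setT f1 by apply: measurable_funD => //; exact: measurable_funM.
have mf2 : measurable_fun setT f2 by apply: measurable_funD => //; exact: measurable_funM.
apply: (@le_trans _ _ (\int[mu]_x (f1 x + f2 x)%:E)%E).
  apply: le_integral_EFin.
  - apply: measurableT_comp => //; apply: measurable_funM => //; exact: measurable_funB.
  - exact: measurable_funD.
  - by move=> x; exact: expR_ge0.
  - by move=> x; apply: (le_trans (hC x)); rewrite /f1 /f2; lra.
have I1 : mu.-integrable setT (EFin \o f1).
  apply: (@bounded_integrable _ _ _ _ _ (`|1 + s * p| + `|s|)) => // x.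
  apply: (le_trans (ler_normD _ _)); rewrite lerD2l normrM normrN.
  by rewrite ler_piMr.
have I2 : mu.-integrable setT (EFin \o f2).
  apply: (@bounded_integrable _ _ _ _ _ `|C * s ^+ 2|) => // x.
  by rewrite /f2 add0r normrM ler_piMr.
under eq_integral do rewrite EFinD.
rewrite integralD//= (integral_affine _ _ _ mY Y_norm) (integral_affine _ _ _ mU U1).
rewrite -EFinD lee_fin -/v -/p; apply: (le_trans _ (expR_ge1Dx _)); lra.
Qed.

(** The exponent s = 2 b / (u + b) minimizes s u^2 / (2 - s) + 2 b^2 / s, whose minimum 2 u b + b^2
    is the right side of (iv) when b^2 is the complexity term. *)
Lemma bernstein_centered (b u : R) : 0 < b ->
  u = Num.sqrt (Ex (fun x => (Y x - p) ^+ 2)) ->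
  (\int[mu]_x (expR (2 * b / (u + b) * (p - Y x)))%:E <=
   (expR (2 * b ^+ 2 * u / (u + b)))%:E)%E.
Proof.
move=> b0 uE; have [p0 p1] := andP Ex01.
have u0 : 0 <= u by rewrite uE sqrtr_ge0.
have uv : u ^+ 2 = Ex (fun x => (Y x - p) ^+ 2) by rewrite uE sqr_sqrtr// variance_ge0.
have ub0 : 0 < u + b by lra.
have ubn0 : u + b != 0 by exact: lt0r_neq0.
set s := 2 * b / (u + b).
have s0 : 0 <= s by rewrite divr_ge0 ?(ltW ub0)// mulr_ge0// ltW.
have s2 : s <= 2 by rewrite ler_pdivrMr//; lra.
have sY x : s * (p - Y x) <= s.
  by rewrite ler_piMr//; have /andP[? ?] := Y01 x; lra.
(* For u = 0 the exponent is exactly 2, the pole of 1 / (2 - s). *)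
have [un0|upos] := eqVneq u 0.
  have := @expR_quad_integral s 10 (fun x => expR_le_quad2 (le_trans (sY x) s2)).
  by rewrite -uv un0 expr0n/= !mulr0 mul0r.
have {}u0 : 0 < u by rewrite lt_neqAle eq_sym upos.
have s2' : s < 2 by rewrite ltr_pdivrMr//; lra.
have h x : expR (s * (p - Y x)) <=
    1 + s * (p - Y x) + (2 - s)^-1 * (s * (p - Y x)) ^+ 2.
  by rewrite [(2 - s)^-1 * _]mulrC; exact: expR_le_quad.
apply: (le_trans (expR_quad_integral h)); rewrite lee_fin ler_expR -uv.
have -> : 2 - s = 2 * u / (u + b) by rewrite /s; field.
rewrite le_eqVlt; apply/orP; left; apply/eqP; rewrite /s; field.
by rewrite upos ubn0.
Qed.

Lemma bernoulli_mean_chord (q N : R) (phi : R -> R) m : 0 <= q <= 1 ->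
  (forall a x, 0 <= a -> a + 1 <= N -> 0 <= x <= 1 ->
     phi (a + x) <= (1 - x) * phi a + x * phi (a + 1)) ->
  forall a x, 0 <= a -> a + 1 + m%:R <= N -> 0 <= x <= 1 ->
  bernoulli_mean q phi m (a + x) <=
  (1 - x) * bernoulli_mean q phi m a + x * bernoulli_mean q phi m (a + 1).
Proof.
move=> /andP[q0 q1] hphi; elim: m => [|m IH] a x a0 aN x01 /=.
  by apply: hphi => //; lra.
have aN' : a + 1 + 1 + m%:R <= N by move: aN; rewrite -natr1; lra.
have h1 := IH a x a0 ltac:(lra) x01.
have h2 := IH (a + 1) x ltac:(lra) aN' x01.
have := @ler_wpM2l _ (1 - q) ltac:(lra) _ _ h1.
have := ler_wpM2l q0 h2.
by rewrite (addrAC a 1 x); lra.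
Qed.

(** Each [Y] is replaced in turn by a Bernoulli variable of the same mean: in its offset
    [bernoulli_mean] lies below its chord, and an affine bound in [Y] integrates to its value at
    p. *)
Lemma tint_bernoulli_le n (N s : R) (phi : R -> R) :
  measurable_fun setT phi -> (forall r, 0 <= phi r) ->
  (forall a x, 0 <= a -> a + 1 <= N -> 0 <= x <= 1 ->
     phi (a + x) <= (1 - x) * phi a + x * phi (a + 1)) ->
  0 <= s -> s + n%:R <= N ->
  (tint (fun=> mu) (fun t : n.-tuple X => (phi (s + \sum_(i < n) Y (tnth t i)))%:E)
   <= (bernoulli_mean p phi n s)%:E)%E.
Proof.
move=> mphi phi0 hphi; elim: n s => [|n IH] s s0 sN.
  by rewrite /tint /= big_ord0 addr0.
have sN' : s + 1 + n%:R <= N by move: sN; rewrite -natr1; lra.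
set b0 := bernoulli_mean p phi n s; set b1 := bernoulli_mean p phi n (s + 1).
apply: (@le_trans _ _ (\int[mu]_x (b0 + (b1 - b0) * Y x)%:E)%E).
  rewrite tintS; apply: ge0_le_integral => //.
  - by move=> x _; apply: tint_ge0 => t; rewrite lee_fin.
  - apply: (@measurable_tint_cons _ _ _ (fun=> mu) n
      (fun t => (phi (s + \sum_(i < n.+1) Y (tnth t i)))%:E)) => [t|].
      by rewrite lee_fin.
    apply/measurable_EFinP; apply: (measurableT_comp mphi).
    by apply: measurable_funD => //; exact: measurable_sum_tnth.
  - by apply/measurable_EFinP; apply: measurable_funD => //; exact: measurable_funM.
  - move=> x _; have /andP[Y0 Y1] := Y01 x.
    under eq_tint do rewrite sum_cons_tuple addrA.
    apply: (le_trans (IH (s + Y x) _ _)); [lra|lra|].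
    rewrite lee_fin; have := bernoulli_mean_chord Ex01 hphi s0 sN' (Y01 x).
    by rewrite -/b0 -/b1; lra.
rewrite (integral_affine _ _ _ mY Y_norm) lee_fin /= -/b0 -/b1 -/p; lra.
Qed.

Lemma ae_eq0_of_Ex (W : X -> R) (M : R) : measurable_fun setT W ->
  (forall x, 0 <= W x <= M) -> Ex W = 0 -> {ae mu, forall x, W x = 0}.
Proof.
move=> mW W0M W0.
have WM x : `|W x| <= M by have /andP[? ?] := W0M x; rewrite ger0_norm.
have mEW : measurable_fun setT (EFin \o W) by exact/measurable_EFinP.
have : (\int[mu]_x `|(EFin \o W) x| = 0)%E.
  rewrite -[RHS]/(0%:E) -W0 -(integral_bounded mu mW WM); apply: eq_integral => x _.
  by rewrite /= ger0_norm//; have /andP[] := W0M x.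
move/(ae_eq_integral_abs mu measurableT mEW); apply: filterS => x /(_ I) /=.
by case.
Qed.

Lemma tint_kl_le n : (3 < n)%N ->
  (tint (fun=> mu) (fun t : n.-tuple X =>
     expeR (n%:R%:E * kl (n%:R^-1 * \sum_(i < n) Y (tnth t i)) p))
   <= (2 * Num.sqrt n%:R)%:E)%E.
Proof.
move=> n3; have n0 : (0 < n)%N by exact: leq_trans n3.
have n0R : (0 : R) < n%:R by rewrite ltr0n.
have nn0 : (n%:R : R) != 0 by exact: lt0r_neq0.
have C1 : 1 <= 2 * Num.sqrt n%:R :> R.
  have : 1 <= Num.sqrt n%:R :> R by rewrite -[leLHS]sqrtr1 ler_sqrt ?ler1n// ltW.
  lra.
have C0 : 0 <= 2 * Num.sqrt n%:R :> R by lra.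
pose m (t : n.-tuple X) := n%:R^-1 * \sum_(i < n) Y (tnth t i).
have m01 t : 0 <= m t <= 1.
  rewrite /m mulrC divr_ge0 ?(ltW n0R)//=; last first.
    by apply: sumr_ge0 => i _; have /andP[] := Y01 (tnth t i).
  rewrite ler_pdivrMr// mul1r (le_trans (ler_sum _ (fun i _ => proj2 (andP (Y01 (tnth t i))))))//.
  by rewrite sumr_const card_ord.
have mm : measurable_fun setT m.
  by apply: measurable_funM => //; exact: measurable_sum_tnth.
have mkl : measurable_fun setT (fun t => expeR (n%:R%:E * kl (m t) p)).
  apply: (measurableT_comp (@measurable_expeR R)).
  apply: emeasurable_funM => //; apply: measurable_kl => // _; exact: Ex01.
(* For p = 0 or p = 1 almost every sample has all [Y] equal to p, so kl vanishes and the integral is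
   at most 1. *)
have [p0|pn0] := eqVneq p 0.
  have h0 := ae_eq0_of_Ex mY Y01 p0.
  apply: (ae_tint_le (S := [set x | Y x = 0])) => // [t|t St].
    exact: expeR_ge0.
  rewrite big1 ?mulr0; last by move=> i _; exact: St.
  rewrite p0 /kl !subr0 [xlr 0 0]/xlr eqxx add0e xlrE// divr1 ln1 mulr0 mule0.
  by rewrite expeR0 lee_fin.
have [p1|pn1] := eqVneq p 1.
  pose W x := 1 + (-1) * Y x.
  have mW : measurable_fun setT W by apply: measurable_funD => //; exact: measurable_funM.
  have W01 x : 0 <= W x <= 1 by rewrite /W; have /andP[? ?] := Y01 x; lra.
  have EW : Ex W = 0.
    by rewrite /Rintegral /W (integral_affine mu _ _ mY Y_norm) /= -/p p1; lra.
  have h0 := ae_eq0_of_Ex mW W01 EW.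
  apply: (ae_tint_le (S := [set x | W x = 0])) => // [t|t St].
    exact: expeR_ge0.
  rewrite (eq_bigr (fun=> 1)); last by move=> i _; have := St i; rewrite /W /=; lra.
  rewrite sumr_const card_ord mulVf// p1.
  rewrite /kl !subrr [xlr 0 0]/xlr eqxx adde0 xlrE// divr1 ln1 mulr0 mule0.
  by rewrite expeR0 lee_fin.
have p01 : 0 < p < 1.
  by have /andP[p0 p1] := Ex01; rewrite !lt_neqAle eq_sym pn0 pn1 p0 p1.
pose phi s : R := expR (n%:R * klr (s / n%:R) p).
have hphi a x : 0 <= a -> a + 1 <= n%:R -> 0 <= x <= 1 ->
    phi (a + x) <= (1 - x) * phi a + x * phi (a + 1).
  by move=> a0 an x01; exact: expR_klr_chord.
have mphi : measurable_fun setT phi.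
  have mln (u : R -> R) : measurable_fun setT u -> measurable_fun setT (fun s => ln (u s)).
    exact: (measurableT_comp (@measurable_ln R)).
  have mn : measurable_fun setT (fun s : R => s / n%:R) by exact: measurable_funM.
  have mn1 : measurable_fun setT (fun s : R => 1 - s / n%:R) by exact: measurable_funB.
  apply: measurableT_comp => //; apply: measurable_funM => //; apply: measurable_funD;
    apply: measurable_funM => //; apply: mln; exact: measurable_funM.
have -> : (fun t : n.-tuple X => expeR (n%:R%:E * kl (n%:R^-1 * \sum_(i < n) Y (tnth t i)) p)) =
    (fun t => (phi (0 + \sum_(i < n) Y (tnth t i)))%:E).
  by apply/funext => t; rewrite klE// -EFinM /= /phi add0r [n%:R^-1 * _]mulrC.
apply: (le_trans (tint_bernoulli_le (N := n%:R) _ _ _ _ _)) => //.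
- by move=> r; exact: expR_ge0.
- by rewrite add0r.
- by rewrite lee_fin bernoulli_mean_expR_klr// maurer_sum_le.
Qed.

End iid_moments.

(** * Generalization bounds *)

(** The tangent of exp at b, arranged with sums only; integrated over [h] it plays the role of
    Jensen's inequality in (ii). *)
Lemma expR_tangent {R : realType} (b y : R) :
  expR b + expR b * y <= expR y + expR b * b.
Proof.
have := ler_wpM2l (expR_ge0 b) (expR_ge1Dx (y - b)).
by rewrite -expRD subrKC; lra.
Qed.

Section generalization_bounds.
Context {R : realType} {dX : measure_display} {X : measurableType dX}.
Variables (mu : probability X R) (n d : nat) (f : d.-tuple R -> X -> R).
Local Notation TR := (measurableTypeR R).
Hypothesis f_meas : measurable_fun setT (fun p : d.-tuple TR * X => f p.1 p.2).
Hypothesis f01 : forall h z, 0 <= f h z <= 1.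
Variables (A : n.-tuple X -> d.-tuple R) (sigma delta : R).
Hypothesis A_meas : measurable_fun [set: n.-tuple X] A.
Hypothesis n_gt0 : (0 < n)%N.
Hypothesis sigma_gt0 : 0 < sigma.
Hypothesis hsigma :
  (((12 * n)%:R)%:E * (hyp_sens A * hyp_sens A) <= (sigma ^+ 2)%:E)%E.
Hypothesis delta_gt0 : 0 < delta.

Let nR_gt0 : (0 : R) < n%:R.
Proof. by rewrite ltr0n. Qed.

Let nR_neq0 : (n%:R : R) != 0.
Proof. exact: lt0r_neq0. Qed.

Let fh_meas h : measurable_fun setT (f h).
Proof. exact: (measurable_uncurry (u := fun=> h) (v := id) f_meas). Qed.

Lemma measurable_Rintegral (g : d.-tuple R -> X -> R) : (forall h z, 0 <= g h z) ->
  measurable_fun setT (fun p : d.-tuple TR * X => g p.1 p.2) ->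
  measurable_fun setT (fun h : d.-tuple TR => Rintegral mu setT (g h)).
Proof.
move=> g0 mg; apply: measurableT_comp => //.
apply: (@measurable_fun_fubini_tonelli_F _ _ _ _ _ mu
  (fun p : d.-tuple TR * X => (g p.1 p.2)%:E)).
- exact/measurable_EFinP.
- by move=> p; rewrite lee_fin.
Qed.

Lemma measurable_Lexp : measurable_fun setT (fun h : d.-tuple TR => Lexp mu f h).
Proof. by apply: measurable_Rintegral => // h z; have /andP[] := f01 h z. Qed.

Lemma Lexp01 h : 0 <= Lexp mu f h <= 1.
Proof. exact: Ex01. Qed.

Lemma measurable_vh : measurable_fun setT (fun h : d.-tuple TR => vh mu f h).
Proof.
apply: (@measurable_Rintegral (fun h z => (f h z - Lexp mu f h) ^+ 2)) => [h z|].
  exact: sqr_ge0.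
apply: measurable_funX; apply: measurable_funB => //.
exact: (measurableT_comp measurable_Lexp).
Qed.

Lemma measurable_Lemp :
  measurable_fun setT (fun p : n.-tuple X * d.-tuple TR => Lemp f p.2 p.1).
Proof.
apply: measurable_funM => //; apply: measurable_sum => i.
apply: (measurable_uncurry (u := snd) (v := fun p => tnth p.1 i) f_meas) => //.
exact: (measurableT_comp (measurable_tnth i)).
Qed.

Lemma Lemp01 h (x : n.-tuple X) : 0 <= Lemp f h x <= 1.
Proof.
rewrite /Lemp mulrC divr_ge0 ?(ltW nR_gt0)//=; last first.
  by apply: sumr_ge0 => i _; have /andP[] := f01 h (tnth x i).
rewrite ler_pdivrMr// mul1r.
rewrite (le_trans (ler_sum _ (fun i _ => proj2 (andP (f01 h (tnth x i))))))//.
by rewrite sumr_const card_ord.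
Qed.

Lemma measurable_gap :
  measurable_fun setT (fun p : n.-tuple X * d.-tuple TR => gap mu f p.2 p.1).
Proof.
apply: measurable_funB; last exact: measurable_Lemp.
exact: (measurableT_comp measurable_Lexp).
Qed.

Lemma gapE h (x : n.-tuple X) :
  n%:R * gap mu f h x = \sum_(i < n) (Lexp mu f h - f h (tnth x i)).
Proof.
rewrite /gap /Lemp mulrBr mulrA divff// mul1r sumrB sumr_const card_ord.
by rewrite mulr_natl.
Qed.

Let a : d.-tuple R := [tuple meanA mu A i | i < d].

Let v : R := fine (VA mu A).

Let VAE : VA mu A = EXn mu (fun x => (\sum_(i < d) (tnth (A x) i - tnth a i) ^+ 2)%:E).
Proof.
congr EXn; apply/funext => x; congr EFin; apply: eq_bigr => i _.
by rewrite tnth_mktuple.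
Qed.

Lemma VA_fin : VA mu A = v%:E /\ 0 <= v.
Proof. by rewrite /v VAE; exact: variance_fin_num hsigma a. Qed.

Lemma EXnEQ_VA_le (G : n.-tuple X -> d.-tuple R -> \bar R) (K : R) : 0 < K ->
  (forall x h, (0 <= G x h)%E) ->
  measurable_fun setT (fun p : n.-tuple X * d.-tuple TR => G p.1 p.2) ->
  (forall h, (EXn mu (fun x => G x h * G x h) <= (K ^+ 2)%:E)%E) ->
  (EXn mu (fun x => EQ A sigma x (G x)) <= (K * expR (3 * v / sigma ^+ 2))%:E)%E.
Proof. by rewrite /v VAE; exact: EXnEQ_le. Qed.

Let klG (x : n.-tuple X) h : \bar R := expeR ((n%:R / 2)%:E * kl (Lemp f h x) (Lexp mu f h)).

Let klF (x : n.-tuple X) h : \bar R := kl (Lemp f h x) (Lexp mu f h).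

Let mklF : measurable_fun setT (fun p : n.-tuple X * d.-tuple TR => klF p.1 p.2).
Proof.
apply: measurable_kl.
- by move=> p; exact: Lemp01.
- by move=> p; exact: Lexp01.
- exact: measurable_Lemp.
- exact: (measurableT_comp measurable_Lexp).
Qed.

Let klF_ge0 x h : (0 <= klF x h)%E.
Proof. by apply: kl_ge0; [exact: Lemp01|exact: Lexp01]. Qed.

Let mklG : measurable_fun setT (fun p : n.-tuple X * d.-tuple TR => klG p.1 p.2).
Proof.
apply: (measurableT_comp (@measurable_expeR R)).
by apply: emeasurable_funM.
Qed.

(** Squaring doubles the exponent n/2 to Maurer's n, so K is the square root of 2 sqrt n. *)
Lemma EXnEQ_kl_le : (3 < n)%N ->
  (EXn mu (fun x => EQ A sigma x (fun h =>
     expeR ((n%:R / 2)%:E * kl (Lemp f h x) (Lexp mu f h)))) <=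
   (expR (ln (2 * Num.sqrt n%:R) / 2 + 3 * v / sigma ^+ 2))%:E)%E.
Proof.
move=> n3; rewrite expRD.
apply: (@EXnEQ_VA_le klG) => //.
- exact: expR_gt0.
- by move=> x h; exact: expeR_ge0.
move=> h; rewrite -expRM_natl mulrCA divff// mulr1 lnK; last first.
  by rewrite posrE mulr_gt0// sqrtr_gt0.
have -> : (fun x => klG x h * klG x h)%E = (fun x : n.-tuple X =>
    expeR (n%:R%:E * kl (n%:R^-1 * \sum_(i < n) f h (tnth x i))
      (Rintegral mu setT (f h)))).
  apply/funext => x; rewrite /klG -expeRD -ge0_muleDl; last 2 first.
  - by rewrite lee_fin divr_ge0 ?ler0n.
  - by rewrite lee_fin divr_ge0 ?ler0n.
  by rewrite -EFinD -splitr.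
exact: tint_kl_le.
Qed.

Lemma theorem9_i : (8 < n)%N ->
  (lne (EXn mu (fun x => EQ A sigma x (fun h =>
     expeR ((n%:R / 2)%:E * kl (Lemp f h x) (Lexp mu f h)))))
   <= (3 / sigma ^+ 2)%:E * VA mu A + (ln (2 * Num.sqrt n%:R) / 2)%:E)%E.
Proof.
move=> n8; have n3 : (3 < n)%N by exact: leq_trans n8.
have [-> v0] := VA_fin; rewrite -EFinM -EFinD.
rewrite -[leRHS]expeRK lee_lne; last 2 first.
- rewrite in_itv/= leey andbT; apply: tint_ge0 => x.
  by apply: tint_ge0 => h; exact: expeR_ge0.
- by rewrite in_itv/= leey andbT lee_fin expR_ge0.
apply: (le_trans (EXnEQ_kl_le n3)); rewrite lee_fin ler_expR; lra.
Qed.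

Lemma theorem9_ii : delta < 1 -> (8 < n)%N ->
  ((1 - delta)%:E <= ProbX mu (fun x : n.-tuple X =>
     EQ A sigma x (fun h => kl (Lemp f h x) (Lexp mu f h))
     <= ((6 / sigma ^+ 2)%:E * VA mu A + (ln (2 * Num.sqrt n%:R))%:E
         + (2 * ln (1 / delta))%:E) * (n%:R^-1)%:E))%E.
Proof.
move=> delta1 n8; have n3 : (3 < n)%N by exact: leq_trans n8.
have [VE v0] := VA_fin.
pose bd := (6 / sigma ^+ 2 * v + ln (2 * Num.sqrt n%:R) + 2 * ln (1 / delta)) / n%:R.
have -> : (((6 / sigma ^+ 2)%:E * VA mu A + (ln (2 * Num.sqrt n%:R))%:E
    + (2 * ln (1 / delta))%:E) * (n%:R^-1)%:E)%E = bd%:E.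
  by rewrite VE -!EFinM.
(* The exponent at the threshold [bd]: it exceeds the logarithm of the bound in (i) by exactly ln (1
   / delta), so Markov's inequality yields delta. *)
pose b := n%:R / 2 * bd.
have bE : b = (ln (2 * Num.sqrt n%:R) / 2 + 3 * v / sigma ^+ 2) + ln (1 / delta).
  by rewrite /b /bd; field; rewrite ?nR_neq0 ?(lt0r_neq0 sigma_gt0).
have b0 : 0 <= b.
  rewrite bE !addr_ge0//.
  - rewrite divr_ge0// ln_ge0//.
    have : 1 <= Num.sqrt n%:R :> R by rewrite -[leLHS]sqrtr1 ler_sqrt ?ler1n// ltW.
    lra.
  - by rewrite divr_ge0 ?sqr_ge0// mulr_ge0.
  - by rewrite ln_ge0// ler_pdivlMr// mul1r ltW.
have mW : measurable_fun setT (fun x => EQ A sigma x (klF x)) by exact: measurable_EQ.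
have mGE : measurable_fun setT (fun x => EQ A sigma x (klG x)).
  by apply: measurable_EQ => // x h; exact: expeR_ge0.
have W0 x : (0 <= EQ A sigma x (klF x))%E by apply: tint_ge0 => h; exact: klF_ge0.
have GE0 x : (0 <= EQ A sigma x (klG x))%E by apply: tint_ge0 => h; exact: expeR_ge0.
pose E : set (n.-tuple X) := [set x | (EQ A sigma x (klF x) <= bd%:E)%E].
have mE : measurable E.
  have := measurable_lee measurableT mW (measurable_cst bd%:E).
  by rewrite setTI.
(* Jensen's inequality in the form needed: if the posterior mean of kl exceeds [bd], the tangent at
   b forces the exponential mean above e^b. The sums are arranged so that every integrand is
   nonnegative, and kl = +oo is treated apart. *)
have tangent x : (~ E x -> (expR b)%:E <= EQ A sigma x (klG x))%E.
  move=> /negP; rewrite -ltNge => Wbd.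
  pose Q := normals sigma (nth 0 (A x)).
  have mkF : measurable_fun setT (fun h : d.-tuple TR => klF x h).
    exact: (measurable_uncurry (u := fun=> x) (v := id) mklF).
  have mkG : measurable_fun setT (fun h : d.-tuple TR => klG x h).
    exact: (measurable_uncurry (u := fun=> x) (v := id) mklG).
  have c0 : 0 <= expR b * (n%:R / 2) by rewrite mulr_ge0 ?expR_ge0// divr_ge0// ltW.
  have e0 : 0 <= expR b * b by rewrite mulr_ge0 ?expR_ge0.
  have : ((expR b)%:E + (expR b * (n%:R / 2))%:E * EQ A sigma x (klF x) <=
      EQ A sigma x (klG x) + (expR b * b)%:E)%E.
    rewrite !EQE -(tintZl Q c0)// -(tint_cst Q d (expR b)) -(tint_cst Q d (expR b * b)).
    have p1 (h : d.-tuple TR) : (0 <= (expR b)%:E)%E by rewrite lee_fin expR_ge0.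
    have p2 (h : d.-tuple TR) : (0 <= (expR b * (n%:R / 2))%:E * klF x h)%E.
      by rewrite mule_ge0.
    have p3 (h : d.-tuple TR) : (0 <= klG x h)%E by exact: expeR_ge0.
    have p4 (h : d.-tuple TR) : (0 <= (expR b * b)%:E)%E by rewrite lee_fin.
    have m2 : measurable_fun setT
        (fun h : d.-tuple TR => (expR b * (n%:R / 2))%:E * klF x h)%E.
      exact: emeasurable_funM.
    rewrite -(tintD Q p1 (measurable_cst _) p2 m2) -(tintD Q p3 mkG p4 (measurable_cst _)).
    apply: le_tint.
    - by move=> h; rewrite adde_ge0// ?mule_ge0// lee_fin expR_ge0.
    - exact: emeasurable_funD.
    - exact: emeasurable_funD.
    - move=> h; rewrite /klG -/(klF x h); move: (klF_ge0 x h).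
      case: (klF x h) => [k| |]// _; last first.
        have -> : ((n%:R / 2)%:E * +oo = +oo :> \bar R)%E.
          by rewrite gt0_muley// lte_fin divr_gt0.
        by rewrite [expeR _]/= addye// leey.
      rewrite -!EFinM -!EFinD lee_fin.
      by rewrite -mulrA; exact: expR_tangent.
  move=> h; rewrite -(@leeD2rE _ (expR b * b)%:E)//; apply: le_trans h.
  rewrite leeD2lE//; apply: (@le_trans _ _ ((expR b * (n%:R / 2))%:E * bd%:E)%E).
    by rewrite -EFinM lee_fin -mulrA.
  by rewrite lee_wpmul2l ?lee_fin// ltW.
have Gle : (EXn mu (fun x => (expR (- b))%:E * EQ A sigma x (klG x)) <= delta%:E)%E.
  rewrite EXnE tintZl ?expR_ge0//.
  apply: (@le_trans _ _ ((expR (- b))%:E *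
    (expR (ln (2 * Num.sqrt n%:R) / 2 + 3 * v / sigma ^+ 2))%:E)%E).
    by rewrite lee_wpmul2l ?lee_fin ?expR_ge0//; exact: EXnEQ_kl_le.
  rewrite -EFinM -expRD lee_fin bE opprD addrAC addNr add0r div1r lnV ?posrE// opprK.
  by rewrite lnK ?posrE.
rewrite EFinB leeBlDr//; apply: (le_trans _ (leeD2l _ Gle)).
have mI : measurable_fun setT (fun x => (\1_E x)%:E : \bar R).
  by apply/measurable_EFinP; exact: measurable_indic.
have mB : measurable_fun setT (fun x => (expR (- b))%:E * EQ A sigma x (klG x))%E.
  exact: emeasurable_funM.
have B0 x : (0 <= (expR (- b))%:E * EQ A sigma x (klG x))%E.
  by rewrite mule_ge0// lee_fin expR_ge0.
rewrite /ProbX !EXnE -tintD//.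
rewrite -(tint_cst (fun=> mu) n 1); apply: le_tint => //.
  exact: emeasurable_funD.
move=> x; rewrite indicE.
have [Ex|nEx] := pselect (E x).
  by rewrite mem_set//= leeDl.
rewrite memNset//= add0e.
apply: (@le_trans _ _ ((expR (- b))%:E * (expR b)%:E)%E).
  by rewrite -EFinM -expRD addNr expR0.
by rewrite lee_wpmul2l ?lee_fin ?expR_ge0//; exact: tangent.
Qed.

Let bound : R := (3 / sigma ^+ 2 * v + ln (1 / delta)) / n%:R.

Let n_bound : n%:R * bound = 3 * v / sigma ^+ 2 + ln (1 / delta).
Proof.
by rewrite /bound; field; rewrite ?nR_neq0 ?(lt0r_neq0 sigma_gt0).
Qed.

(* Chernoff bound with an exponent s that may depend on the hypothesis h. *)
Lemma deviation (s theta : d.-tuple R -> R) (E : n.-tuple X -> d.-tuple R -> Prop) :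
  measurable_fun setT (fun h : d.-tuple TR => s h) ->
  measurable_fun setT (fun h : d.-tuple TR => theta h) ->
  (forall h, (\int[mu]_z (expR (s h * (Lexp mu f h - f h z)))%:E <= (expR (theta h))%:E)%E) ->
  measurable [set p : n.-tuple X * d.-tuple TR | E p.1 p.2] ->
  (forall x h, ~ E x h -> theta h + 2 * bound <= s h * gap mu f h x) ->
  ((1 - delta)%:E <= ProbXQ mu A sigma E)%E.
Proof.
move=> ms mtheta mgf mE nE.
(* The factor n/2 makes the square of [G] an exponential of an i.i.d. sum; the shift n [bound] makes
   [G] at least 1 off [E] and cancels exp (3 v / sigma^2) down to delta. *)
pose G (x : n.-tuple X) (h : d.-tuple R) : \bar R := (expR (n%:R / 2 *
  (s h * gap mu f h x - theta h) - n%:R * bound))%:E.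
have G0 x h : (0 <= G x h)%E by rewrite lee_fin expR_ge0.
have mG : measurable_fun setT (fun p : n.-tuple X * d.-tuple TR => G p.1 p.2).
  apply/measurable_EFinP; apply: measurableT_comp => //.
  apply: measurable_funB => //; apply: measurable_funM => //.
  apply: measurable_funB; last exact: (measurableT_comp mtheta).
  by apply: measurable_funM; [exact: (measurableT_comp ms)|exact: measurable_gap].
apply: (EXnEQ_markov A_meas sigma_gt0 mE G0 mG).
  move=> x h /nE h1; rewrite lee_fin -[leLHS]expR0 ler_expR.
  have n20 : 0 <= n%:R / 2 :> R by rewrite divr_ge0// ltW.
  have := ler_wpM2l n20 h1.
  move: (s h * gap mu f h x) (theta h) (bound) (n%:R) => y th B N; lra.
apply: (le_trans (@EXnEQ_VA_le G (expR (- (n%:R * bound))) (expR_gt0 _) G0 mG _)).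
  move=> h.
  have -> : (fun x => G x h * G x h)%E = (fun x => (expR (- (n%:R * theta h) - 2 * (n%:R * bound)))%:E *
      (expR (\sum_(i < n) (s h * (Lexp mu f h - f h (tnth x i)))))%:E)%E.
    apply/funext => x; rewrite /G -!EFinM -!expRD -mulr_sumr -gapE.
    by congr (expR _)%:E; field.
  rewrite EXnE tintZl ?expR_ge0//; last first.
    apply/measurable_EFinP; apply: measurableT_comp => //.
    apply: (@measurable_sum_tnth _ _ _ n (fun z => s h * (Lexp mu f h - f h z))).
    by apply: measurable_funM => //; exact: measurable_funB.
  apply: (@le_trans _ _ ((expR (- (n%:R * theta h) - 2 * (n%:R * bound)))%:E *
      (expR (theta h) ^+ n)%:E)%E).
    rewrite lee_wpmul2l ?lee_fin ?expR_ge0//.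
    apply: (@tint_expR_sum_le _ _ _ mu n (fun z => s h * (Lexp mu f h - f h z))) => //.
    by apply: measurable_funM => //; exact: measurable_funB.
  rewrite -EFinM -!expRM_natl -expRD lee_fin ler_expR; lra.
rewrite -expRD n_bound lee_fin opprD addrAC addNr add0r div1r lnV ?posrE// opprK.
by rewrite lnK ?posrE.
Qed.

Let bound_gt0 : delta < 1 -> 0 < bound.
Proof.
move=> d1; have [_ v0] := VA_fin; rewrite divr_gt0// ltr_wpDl//.
  by rewrite mulr_ge0// divr_ge0// sqr_ge0.
by rewrite ln_gt0// ltr_pdivlMr// mul1r.
Qed.

Let boundE : (((3 / sigma ^+ 2)%:E * VA mu A + (ln (1 / delta))%:E) * (n%:R^-1)%:E)%E
  = bound%:E.
Proof. by have [-> _] := VA_fin; rewrite -!EFinM. Qed.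

Lemma theorem9_iii : delta < 1 ->
  ((1 - delta)%:E <= ProbXQ mu A sigma (fun x h => (gap mu f h x)%:E <=
    sqrte (((3 / sigma ^+ 2)%:E * VA mu A + (ln (1 / delta))%:E) * (n%:R^-1)%:E)))%E.
Proof.
move=> d1; rewrite boundE /=; have B0 := bound_gt0 d1.
set b := Num.sqrt bound; have b2 : b ^+ 2 = bound by rewrite sqr_sqrtr// ltW.
have b0 : 0 <= b by exact: sqrtr_ge0.
(* The value s = 4 b minimizes s / 8 + 2 b^2 / s, with minimum b. *)
apply: (@deviation (fun=> 4 * b) (fun=> 2 * b ^+ 2)) => //.
- move=> h; apply: (le_trans (hoeffding_centered mu (fh_meas h) (f01 h) _)).
  by rewrite lee_fin ler_expR exprMn; lra.
- have := measurable_lee measurableT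
    (measurableT_comp (@EFin_measurable R setT) measurable_gap) (measurable_cst b%:E).
  by rewrite setTI.
- move=> x h /negP; rewrite lee_fin -ltNge => /ltW hb.
  by have := ler_wpM2l b0 hb; rewrite -b2 expr2; lra.
Qed.

Lemma theorem9_iv : delta < 1 ->
  let B := (((3 / sigma ^+ 2)%:E * VA mu A + (ln (1 / delta))%:E) * (n%:R^-1)%:E)%E in
  ((1 - delta)%:E <= ProbXQ mu A sigma (fun x h => (gap mu f h x)%:E <=
    2%:E * sqrte ((vh mu f h)%:E * B) + B))%E.
Proof.
move=> d1; rewrite boundE; have B0 := bound_gt0 d1.
set b := Num.sqrt bound; have b2 : b ^+ 2 = bound by rewrite sqr_sqrtr// ltW.
have b0 : 0 < b by rewrite sqrtr_gt0.
pose u h := Num.sqrt (vh mu f h).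
have u0 h : 0 <= u h by exact: sqrtr_ge0.
have ub h : 0 < u h + b by rewrite ltr_wpDl.
have mu' : measurable_fun setT (fun h : d.-tuple TR => u h).
  exact: (measurableT_comp (@measurable_sqrt R) measurable_vh).
have mub : measurable_fun setT (fun h : d.-tuple TR => (u h + b)^-1).
  (* Positivity lets the inverse be written with [expR] and [ln], whose measurability is at hand. *)
  have -> : (fun h : d.-tuple TR => (u h + b)^-1) = (fun h => expR (- ln (u h + b))).
    by apply/funext => h; rewrite expRN lnK ?posrE ?ub.
  apply: measurableT_comp => //; apply: measurableT_comp => //.
  by apply: (measurableT_comp (@measurable_ln R)); exact: measurable_funD.
have rhsE h : (2%:E * sqrte ((vh mu f h)%:E * bound%:E) + bound%:E)%E =
    (2 * (u h * b) + b ^+ 2)%:E.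
  by rewrite -EFinM /= sqrtrM ?variance_ge0// b2.
(* The exponent depends on the variance of [h]; with it, the condition theta + 2 b^2 <= s (2 u b +
   b^2) is an equality. *)
apply: (@deviation (fun h => 2 * b / (u h + b)) (fun h => 2 * b ^+ 2 * u h / (u h + b))).
- exact: measurable_funM.
- by apply: measurable_funM => //; exact: measurable_funM.
- by move=> h; apply: bernstein_centered.
- have mrhs : measurable_fun setT
      (fun p : n.-tuple X * d.-tuple TR => (2 * (u p.2 * b) + b ^+ 2)%:E).
    apply/measurable_EFinP; apply: measurable_funD => //.
    apply: measurable_funM => //; apply: measurable_funM => //.
    exact: (measurableT_comp mu').
  have := measurable_lee measurableT
    (measurableT_comp (@EFin_measurable R setT) measurable_gap) mrhs.
  rewrite setTI; congr measurable; apply/seteqP.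
  by split => p /=; rewrite rhsE.
- move=> x h; rewrite rhsE => /negP; rewrite lee_fin -ltNge => /ltW hb.
  have ubn0 : u h + b != 0 by exact: lt0r_neq0.
  have c0 : 0 <= 2 * b / (u h + b) by rewrite divr_ge0 ?(ltW (ub h))// mulr_ge0// ltW.
  apply: (le_trans _ (ler_wpM2l c0 hb)); rewrite -b2.
  by rewrite le_eqVlt; apply/orP; left; apply/eqP; field.
Qed.

End generalization_bounds.

Theorem theorem9 (R : realType) (dX : measure_display) (X : measurableType dX)
  (mu : probability X R) (n d : nat)
  (f : d.-tuple R -> X -> R)
  (f_meas : measurable_fun [set: d.-tuple R * X] (fun p => f p.1 p.2))
  (f01 : forall h z, 0 <= f h z <= 1)
  (A : n.-tuple X -> d.-tuple R) (A_meas : measurable_fun [set: n.-tuple X] A)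
  (sigma delta : R) (n_gt0 : (0 < n)%N) (sigma_gt0 : 0 < sigma)
  (hsigma : (((12 * n)%:R)%:E * (hyp_sens A * hyp_sens A) <= (sigma ^+ 2)%:E)%E)
  (delta_gt0 : 0 < delta) :
  let Lhat h x := Lemp f h x in
  let L h := Lexp mu f h in
  let V := VA mu A in
  let B := (((3 / sigma ^+ 2)%:E * V + (ln (1 / delta))%:E) * (n%:R^-1)%:E)%E in
  [/\ (* (i) *)
      (8 < n)%N ->
        (lne (EXn mu (fun x => EQ A sigma x
               (fun h => expeR ((n%:R / 2)%:E * kl (Lhat h x) (L h)))))
         <= (3 / sigma ^+ 2)%:E * V + (ln (2 * Num.sqrt n%:R) / 2)%:E)%E,
      (* (ii) *)
      (8 < n)%N ->
        ((1 - delta)%:E <= ProbX mu (fun x =>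
           EQ A sigma x (fun h => kl (Lhat h x) (L h))
           <= ((6 / sigma ^+ 2)%:E * V + (ln (2 * Num.sqrt n%:R))%:E
               + (2 * ln (1 / delta))%:E) * (n%:R^-1)%:E))%E,
      (* (iii) *)
      ((1 - delta)%:E <= ProbXQ mu A sigma (fun x h =>
          (gap mu f h x)%:E <= sqrte B))%E
    & (* (iv) *)
      ((1 - delta)%:E <= ProbXQ mu A sigma (fun x h =>
          (gap mu f h x)%:E <= 2%:E * sqrte ((vh mu f h)%:E * B) + B))%E].
Proof.
move=> Lhat L V B.
have ProbXQ_ge0 E : (0 <= ProbXQ mu A sigma E)%E.
  by apply: tint_ge0 => x; apply: tint_ge0 => h; rewrite lee_fin.
have ProbX_ge0 E : (0 <= ProbX mu (E : n.-tuple X -> Prop))%E.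
  by apply: tint_ge0 => x; rewrite lee_fin.
(* For delta >= 1 the probability bounds are trivial, while ln (1 / delta) <= 0 would spoil the
   positivity of the thresholds. *)
have [delta_ge1|delta_lt1] := leP 1 delta.
  have d0 : ((1 - delta)%:E <= 0%:E :> \bar R)%E by rewrite lee_fin subr_le0.
  split; [exact: theorem9_i|move=> _|..]; exact: le_trans d0 _.
split.
- exact: theorem9_i.
- exact: theorem9_ii.
- exact: theorem9_iii.
- exact: theorem9_iv.
Qed.
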